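(* Let $(a_k)_{k\ge 0}$ be a sequence of i.i.d. (possibly complex) random variables with $\mathbb{E}[\log(1+|a_0|)]<\infty$, and let $$F(z)=\sum_{k=0}^\infty a_k z^k,$$ which almost surely defines an analytic function in the unit disk $\mathbb{D}$. Then $$\mathbb{P}\big[\exists\,\alpha\in\mathbb{D}\ \text{such that}\ F(\alpha)=F'(\alpha)=0\big]=\mathbb{P}\big[F(0)=F'(0)=0\big]=\big(\mathbb{P}[a_0=0]\big)^2 .$$
   Context: $\mathbb{D}=\{z\in\mathbb{C}:|z|<1\}$. *)

(* Defs.v *)
From HB Require Import structures.
From mathcomp Require Import all_boot all_order all_algebra.
From mathcomp Require Import all_classical all_reals all_analysis.
From mathcomp Require Import finmap complex.
Set Implicit Arguments.
Unset Strict Implicit.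
Unset Printing Implicit Defensive.
Import Order.TTheory GRing.Theory Num.Theory.
Import numFieldNormedType.Exports.
Local Open Scope classical_set_scope.
Local Open Scope ring_scope.
Local Open Scope complex_scope.

(* real-closed provides R[i] as a numClosedFieldType but puts no topology on
   it; this transfers the norm topology that the analysis library attaches to
   every numFieldType, so that limits and 'derive1' on R[i] are complex. *)
HB.instance Definition _ (R : realType) := NormedModule.copy R[i] R[i]^o.

Section ComplexRandomVariables.
Context {R : realType} {d : measure_display} {T : measurableType d}.
Implicit Types (P : probability T R) (X : T -> R[i]) (a : nat -> T -> R[i]).

Definition borelC : set (set R[i]) := <<s open >>.

Definition complex_rv X := forall B, borelC B -> measurable (X @^-1` B).

Definition independent_seq P a :=
  forall (J : {fset nat}) (B : nat -> set R[i]),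
    (forall k, k \in J -> borelC (B k)) ->
    P (\bigcap_(k in [set` J]) (a k @^-1` B k)) =
    (\prod_(k <- J) P (a k @^-1` B k))%E.

Definition identically_distributed P a :=
  forall k B, borelC B -> P (a k @^-1` B) = P (a 0%N @^-1` B).

Definition iid_seq P a :=
  [/\ forall k, complex_rv (a k), independent_seq P a
    & identically_distributed P a].

End ComplexRandomVariables.

Section PowerSeries.
Context {R : realType}.
Implicit Types (c : nat -> R[i]) (z : R[i]).

Definition unit_disk : set R[i] := [set z | `|z| < 1].

Definition power_series c z : R[i] := limn (series (fun k => c k * z ^+ k)).

(* 'limn' and 'derive1' are total: the values of 'power_series c' and of its
   derivative on the disk are meaningful only under this condition. The
   quotients in 'derivable _ z 1' run over complex increments, so this is
   holomorphy. *)
Definition analytic_power_series c :=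
  forall z, unit_disk z ->
    cvgn (series (fun k => c k * z ^+ k)) /\ derivable (power_series c) z 1.

End PowerSeries.

(* Main.v *)
Require Import Defs.
From mathcomp Require Import all_boot all_order all_algebra.
From mathcomp Require Import all_classical all_reals all_analysis.
From mathcomp Require Import finmap complex.
From mathcomp Require Import measurable_realfun.
From mathcomp Require Import ring lra.

(** Let D_j(x)(z) = sum k^j x_k z^k, the j-th Euler iterate of the power series
    with coefficients x.  At a point alpha <> 0 the function F and its
    derivative vanish iff D_0 and D_1 do, and by the identity theorem
    ([finite_order]) a nonzero series with such a zero satisfies
    D_j(alpha) = D_j+1(alpha) = 0 <> D_j+2(alpha) for some j.  So alpha is a
    zero of D_j of multiplicity exactly two.

    The heart of the proof is deterministic ([swap_rigidity]).  Suppose that x,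
    and also x with its coefficients of index N and N+1 exchanged, have such
    zeros beta and gamma in the same small box, with uniform bounds on the
    coefficients and on D_j+2 from below.  Taylor expansion at gamma makes D_j
    of the exchanged sequence O(|beta - gamma|^2) at beta, and D_j+1 at least a
    constant times |beta - gamma|.  But at beta the two series differ only by a
    multiple of z^N - z^(N+1), for which D_j and D_j+1 have the same
    exponentially small size, up to powers of N.  For large N this is possible
    only if x_N = x_N+1.

    Probability enters through two facts about an event A of the space of
    sequences: exchanging the coordinates N and N+1 preserves the law and
    changes A by an event of probability tending to 0 ([swap_asymptotic]), and A
    is asymptotically independent of (a_N, a_N+1) ([mixing]).  If the law of a_0
    charges two disjoint sets B and B', the event that a belongs to A and that
    a_N, a_N+1 belong to B, B' has probability close to P(A) mu(B) mu(B'); if A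
    is one of the events of the previous paragraph, it also has probability
    close to 0.  Hence P(A) = 0 ([swap_rigid_null]), and countably many such A
    exhaust the nonzero double zeros ([double_zero_off_0_cover]).  Otherwise all
    a_k agree almost surely and F(z) = a_0 / (1 - z)
    ([separation_or_constant], [constant_coef_eq0]).

    The remaining claims are that the series almost surely converges in the
    disk, by Borel-Cantelli ([ae_tame]), and that the events are measurable: the
    existence of a zero in a compact box is a countable condition on the values
    at rational points ([zero_on_square_measurable]).  At 0, the condition
    F(0) = F'(0) = 0 reads a_0 = a_1 = 0. *)

Set Implicit Arguments.
Unset Strict Implicit.
Unset Printing Implicit Defensive.
Import Order.TTheory GRing.Theory Num.Theory.
Import numFieldNormedType.Exports.
Local Open Scope classical_set_scope.
Local Open Scope ring_scope.
Local Open Scope complex_scope.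
Local Notation nc := (@Normc.normc _).

(** * Absolutely convergent series of complex numbers *)

Section ComplexSeries.
Context {R : realType}.
Implicit Types (u v : nat -> R[i]) (z y w : R[i]) (g : nat -> R).

Lemma normrc z : `|z| = (nc z)%:C.
Proof. by rewrite normc_def; case: z. Qed.

Lemma nc_ge0 z : 0 <= nc z.
Proof. by case: z => x y; rewrite /= sqrtr_ge0. Qed.

Lemma nc0 : nc (0 : R[i]) = 0. Proof. exact: Normc.normc0. Qed.

Lemma nc1 : nc (1 : R[i]) = 1. Proof. exact: Normc.normc1. Qed.

Lemma nc_eq0 z : (nc z == 0) = (z == 0).
Proof.
by apply/eqP/eqP => [/Normc.eq0_normc//|->]; rewrite nc0.
Qed.

Lemma nc_gt0 z : (0 < nc z) = (z != 0).
Proof. by rewrite lt_neqAle nc_ge0 andbT eq_sym nc_eq0. Qed.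

Lemma ncM z y : nc (z * y) = nc z * nc y. Proof. exact: Normc.normcM. Qed.

Lemma ncV z : nc z^-1 = (nc z)^-1. Proof. exact: Normc.normcV. Qed.

Lemma ncN z : nc (- z) = nc z. Proof. exact: normcN. Qed.

Lemma ncD z y : nc (z + y) <= nc z + nc y. Proof. exact: le_normcD. Qed.

Lemma ncB z y : nc (z - y) <= nc z + nc y.
Proof. by rewrite -[nc y]ncN ncD. Qed.

Lemma nc_distC z y : nc (z - y) = nc (y - z).
Proof. by rewrite -ncN opprB. Qed.

Lemma nc_subl z y : nc z - nc y <= nc (z - y).
Proof. by rewrite lerBlDr (le_trans _ (ncD _ _))// subrK. Qed.

Lemma ncX z n : nc (z ^+ n) = nc z ^+ n.
Proof. by elim: n => [|n ih]; rewrite ?expr0 ?nc1// !exprS ncM ih. Qed.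

Lemma nc_real (x : R) : nc x%:C = `|x|.
Proof. by rewrite /= expr0n/= addr0 sqrtr_sqr. Qed.

Lemma nc_nat n : nc (n%:R : R[i]) = n%:R.
Proof. by rewrite -(rmorph_nat (real_complex R)) nc_real normr_nat. Qed.

Lemma ReD z y : complex.Re (z + y) = complex.Re z + complex.Re y.
Proof. by case: z y => [? ?] [? ?]. Qed.

Lemma ImD z y : complex.Im (z + y) = complex.Im z + complex.Im y.
Proof. by case: z y => [? ?] [? ?]. Qed.

Lemma nc_ge_Re z : `|complex.Re z| <= nc z.
Proof.
case: z => x y /=; rewrite -sqrtr_sqr ler_wsqrtr// lerDl sqr_ge0//.
Qed.

Lemma nc_ge_Im z : `|complex.Im z| <= nc z.
Proof.
case: z => x y /=; rewrite -[X in X <= _]sqrtr_sqr ler_wsqrtr// lerDr sqr_ge0//.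
Qed.

Lemma nc_le_ReIm z : nc z <= `|complex.Re z| + `|complex.Im z|.
Proof.
case: z => x y.
have -> : x +i* y = x%:C + (0 +i* y).
  by apply/eqP; rewrite eq_complex /= add0r addr0 !eqxx.
apply: (le_trans (ncD _ _)); rewrite nc_real /=.
by rewrite add0r addr0 expr0n/= add0r sqrtr_sqr.
Qed.

Lemma cvg_ncP u z : u @ \oo --> z <->
  forall e : R, 0 < e -> exists N, forall n, (N <= n)%N -> nc (z - u n) < e.
Proof.
split.
  move=> /cvgrPdist_lt uz e e0.
  have /uz[N _ NP] : (0 : R[i]) < e%:C by rewrite ltcR.
  by exists N => n Nn; have := NP n Nn; rewrite /= normrc ltcR.
move=> uz; apply/cvgrPdist_lt => -[e e'].
rewrite ltcE/= => /andP[/eqP -> e0].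
have [N NP] := uz _ e0.
by exists N => // n Nn /=; rewrite normrc ltcR; exact: NP.
Qed.

(** Passing to the real and imaginary parts reduces completeness of R[i] to
    that of R. *)
Lemma dominated_cvg u g : (forall k, nc (u k) <= g k) -> cvgn (series g) ->
  cvgn (series u).
Proof.
move=> ug cg.
have cR : cvgn (series (fun k => complex.Re (u k))).
  apply: normed_cvg; apply: series_le_cvg cg => k /=; first exact: normr_ge0.
  - by apply: le_trans (ug k); exact: nc_ge0.
  - by apply: le_trans (ug k); exact: nc_ge_Re.
have cI : cvgn (series (fun k => complex.Im (u k))).
  apply: normed_cvg; apply: series_le_cvg cg => k /=; first exact: normr_ge0.
  - by apply: le_trans (ug k); exact: nc_ge0.
  - by apply: le_trans (ug k); exact: nc_ge_Im.
pose a := limn (series (fun k => complex.Re (u k))).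
pose b := limn (series (fun k => complex.Im (u k))).
have sE n : series u n = series (fun k => complex.Re (u k)) n +i*
                         series (fun k => complex.Im (u k)) n.
  rewrite /series/=; elim: n => [|n ih]; first by rewrite !big_geq.
  by rewrite !big_nat_recr//= ih; case: (u n).
apply/cvg_ex; exists (a +i* b); apply/cvg_ncP => e e0.
move/cvgrPdist_lt : (cR) => /(_ (e / 2)); rewrite divr_gt0// => /(_ isT)[N1 _ H1].
move/cvgrPdist_lt : (cI) => /(_ (e / 2)); rewrite divr_gt0// => /(_ isT)[N2 _ H2].
exists (maxn N1 N2) => n; rewrite geq_max => /andP[n1 n2].
apply: (le_lt_trans (nc_le_ReIm _)); rewrite sE /= [ltRHS]splitr.
by apply: ltrD; [exact: H1|exact: H2].
Qed.

Definition csum u : R[i] := limn (series u).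

Definition asum u := cvgn (series (fun k => nc (u k))).

Lemma asum_le u g : (forall k, nc (u k) <= g k) -> cvgn (series g) -> asum u.
Proof.
move=> ug; apply: series_le_cvg => // k; first exact: nc_ge0.
by apply: le_trans (ug k); exact: nc_ge0.
Qed.

Lemma csum_cvg u : asum u -> series u @ \oo --> csum u.
Proof. exact: dominated_cvg. Qed.

Lemma csum_unique u z : series u @ \oo --> z -> csum u = z.
Proof. by move=> uz; apply/cvg_lim. Qed.

Lemma nc_csum u g : (forall k, nc (u k) <= g k) -> cvgn (series g) ->
  nc (csum u) <= limn (series g).
Proof.
move=> ug cg; apply/ler_addgt0Pr => e e0.
have /csum_cvg/cvg_ncP/(_ e e0)[N /(_ N (leqnn N))] := asum_le ug cg.
move=> /ltW h; rewrite -[csum u](subrK (series u N)).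
apply: (le_trans (ncD _ _)); rewrite addrC lerD//.
apply: (@le_trans _ _ (series g N)).
  rewrite /series/=; elim: N {h} => [|n ih]; first by rewrite !big_geq// nc0.
  by rewrite !big_nat_recr//= (le_trans (ncD _ _))// lerD.
apply: nondecreasing_cvgn_le => //; apply/nondecreasing_seqP => n.
by rewrite seriesSr lerDl (le_trans _ (ug n))// nc_ge0.
Qed.

Lemma asumD u v : asum u -> asum v -> asum (fun k => u k + v k).
Proof.
move=> au av.
by apply: (@asum_le _ (fun k => nc (u k) + nc (v k)));
  [move=> k; exact: ncD|exact: is_cvg_seriesD].
Qed.

Lemma asumZ w u : asum u -> asum (fun k => w * u k).
Proof.
move=> au; apply: (@asum_le _ (nc w *: (fun k => nc (u k)))).
  by move=> k; rewrite ncM.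
exact: is_cvg_seriesZ.
Qed.

Lemma asumB u v : asum u -> asum v -> asum (fun k => u k - v k).
Proof.
move=> au av.
by apply: (@asum_le _ (fun k => nc (u k) + nc (v k)));
  [move=> k; exact: ncB|exact: is_cvg_seriesD].
Qed.

Lemma csumD u v : asum u -> asum v ->
  csum (fun k => u k + v k) = csum u + csum v.
Proof.
move=> au av; apply: csum_unique.
have -> : series (fun k => u k + v k) = series u \+ series v.
  by apply/funext => n; rewrite /series/= big_split.
by apply: cvgD; exact: csum_cvg.
Qed.

Lemma csumZ w u : asum u -> csum (fun k => w * u k) = w * csum u.
Proof.
move=> au; apply: csum_unique.
have -> : series (fun k => w * u k) = (fun n => w * series u n).
  by apply/funext => n; rewrite /series/= mulr_sumr.
by apply: cvgMl_tmp; exact: csum_cvg.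
Qed.

Lemma csumB u v : asum u -> asum v ->
  csum (fun k => u k - v k) = csum u - csum v.
Proof.
move=> au av; rewrite -[in RHS](mulN1r (csum v)) -csumZ// -csumD//.
  by congr csum; apply/funext => k; rewrite mulN1r.
exact: asumZ.
Qed.

Lemma csum_finite u n : (forall k, (n <= k)%N -> u k = 0) ->
  series u @ \oo --> \sum_(0 <= k < n) u k.
Proof.
move=> u0; apply/cvg_ncP => e e0; exists n => m nm.
rewrite /series/= (big_cat_nat _ nm)//= [X in _ - (_ + X)](_ : _ = 0) ?addr0.
  by rewrite subrr nc0.
by rewrite big_nat big1// => i /andP[/u0].
Qed.

Lemma csum_single u n : (forall k, k != n -> u k = 0) -> csum u = u n.
Proof.
move=> u0; have := @csum_finite u n.+1; rewrite big_nat_recr//= big_nat big1.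
  rewrite add0r => h; apply/csum_unique/h => k nk.
  by apply: u0; rewrite gt_eqF.
by move=> k /andP[_ kn]; rewrite u0// lt_eqF.
Qed.

Lemma asum_single u n : (forall k, k != n -> u k = 0) -> asum u.
Proof.
move=> u0; apply/cvg_ex; exists (nc (u n)).
apply: (@cvg_near_cst _ _ _ _ _ _ _); exists n.+1 => // m /= nm.
rewrite /series/= (bigD1_seq n)/= ?iota_uniq ?mem_index_iota//.
by rewrite big1 ?addr0// => i /u0 ->; rewrite nc0.
Qed.

End ComplexSeries.

(** * Geometric domination with polynomial weights *)

Section GeometricWeights.
Context {R : realType}.
Implicit Types (q rho sigma M : R) (u : nat -> R[i]).

Lemma natr_mul_geo q k : 0 <= q <= 1 -> k%:R * q ^+ k * (1 - q) <= 1 - q ^+ k.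
Proof.
move=> /andP[q0 q1]; elim: k => [|k ih]; first by rewrite !mul0r expr0 subrr.
have qk0 : 0 <= q ^+ k by exact: exprn_ge0.
have qk1 : q ^+ k <= 1 by exact: exprn_ile1.
have := ler_wpM2l q0 ih; rewrite !exprS -natr1 => h.
have : q ^+ k * (q * (1 - q)) <= 1 * (1 - q).
  apply: ler_pM => //; first by rewrite mulr_ge0// subr_ge0.
  by rewrite ler_piMl// subr_ge0.
move: h; set p := q ^+ k; nra.
Qed.

(** By induction on j: each factor k costs an arbitrarily small increase of the
    rate, because k q^k is bounded by 1 / (1 - q). *)
Lemma natrX_geo j rho sigma : 0 <= rho < sigma ->
  exists2 M, 0 <= M & forall k, k%:R ^+ j * rho ^+ k <= M * sigma ^+ k.
Proof.
elim: j rho => [|j ih] rho /andP[rho0 rhos].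
  exists 1 => // k; rewrite expr0 !mul1r.
  by rewrite lerXn2r// ?nnegrE// ltW// (le_lt_trans rho0).
pose tau := (rho + sigma) / 2.
have rt : rho < tau by rewrite /tau; lra.
have t0 : 0 < tau by exact: le_lt_trans rt.
have [|M M0 HM] := ih tau; first by rewrite (ltW t0)/= /tau; lra.
pose q := rho / tau.
have q0 : 0 <= q by rewrite divr_ge0// ltW.
have q1 : q < 1 by rewrite ltr_pdivrMr// mul1r.
exists (M / (1 - q)); first by rewrite divr_ge0// subr_ge0 ltW.
move=> k.
have -> : rho ^+ k = q ^+ k * tau ^+ k.
  by rewrite -exprMn mulfVK// gt_eqF.
have kq : k%:R * q ^+ k <= (1 - q)^-1.
  rewrite -[leRHS]mul1r ler_pdivlMr ?subr_gt0//.
  apply: (le_trans (natr_mul_geo _ _)); first by rewrite q0 ltW.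
  by rewrite gerBl exprn_ge0.
rewrite exprSr mulrACA [leRHS]mulrAC.
rewrite [X in X <= _](_ : _ = (k%:R ^+ j * tau ^+ k) * (k%:R * q ^+ k)); last by ring.
apply: ler_pM => //.
- by rewrite mulr_ge0// exprn_ge0// ltW.
- by rewrite mulr_ge0// exprn_ge0.
Qed.

Lemma geo_cvg M rho : 0 <= rho < 1 -> cvgn (series (fun k => M * rho ^+ k)).
Proof.
by move=> /andP[r0 r1]; apply: is_cvg_geometric_series; rewrite ger0_norm.
Qed.

Lemma natrX_geo_cvg M j rho : 0 <= rho < 1 ->
  cvgn (series (fun k => M * (k%:R ^+ j * rho ^+ k))).
Proof.
move=> /andP[r0 r1]; apply: (@is_cvg_seriesZ _ (fun k => _) M).
have [|C C0 HC] := @natrX_geo j rho ((rho + 1) / 2); first by rewrite r0/=; lra.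
apply: (series_le_cvg _ _ HC).
- by move=> k; rewrite mulr_ge0// exprn_ge0.
- by move=> k; rewrite mulr_ge0// exprn_ge0//; lra.
- by apply: geo_cvg; lra.
Qed.

Lemma natrX_geo_small M j rho (e : R) : 0 <= rho < 1 -> 0 < e ->
  exists N, forall k, (N <= k)%N -> M * (k%:R ^+ j * rho ^+ k) < e.
Proof.
move=> r01 e0; have /cvg_series_cvg_0/cvgrPdist_lt/(_ e e0)[N _ HN] :=
  @natrX_geo_cvg M j rho r01.
exists N => k /HN /=; rewrite sub0r normrN; apply: le_lt_trans.
exact: ler_norm.
Qed.

Definition geo_dominated rho u := exists M, forall k, nc (u k) <= M * rho ^+ k.

Lemma geo_dominated_asum rho u : 0 <= rho < 1 -> geo_dominated rho u -> asum u.
Proof. by move=> r01 [M HM]; apply: asum_le HM _; exact: geo_cvg. Qed.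

Lemma geo_dominatedB rho u v : geo_dominated rho u -> geo_dominated rho v ->
  geo_dominated rho (fun k => u k - v k).
Proof.
move=> [M HM] [M' HM']; exists (M + M') => k.
by rewrite mulrDl (le_trans (ncB _ _))// lerD.
Qed.

Lemma geo_dominatedZ rho u w : geo_dominated rho u ->
  geo_dominated rho (fun k => w * u k).
Proof.
by move=> [M HM]; exists (nc w * M) => k; rewrite ncM -mulrA ler_wpM2l// nc_ge0.
Qed.

End GeometricWeights.

(** * Identity theorem for sequences with vanishing moments *)

Section VanishingMoments.
Context {R : realType}.
Implicit Types (b u : nat -> R[i]) (rho sigma x : R).

(** All the weighted sequences decay at one and the same rate, so that the
    continuation step below has a length that does not depend on the weight. *)
Definition smooth_moments sigma b :=
  (forall j, geo_dominated sigma (fun k => k%:R ^+ j * b k)) /\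
  (forall j, csum (fun k => k%:R ^+ j * b k) = 0).

(** Binomials are polynomials in k, so binomial moments vanish as well; the
    recursion 'C(k, i+1) = 'C(k, i) (k - i) / (i+1) trades the degree for a
    change of sequence. *)
Lemma smooth_moments_bin sigma i b : 0 <= sigma < 1 -> smooth_moments sigma b ->
  geo_dominated sigma (fun k => 'C(k, i)%:R * b k) /\
  csum (fun k => 'C(k, i)%:R * b k) = 0.
Proof.
move=> s01; elim: i b => [|i ih] b [db mb].
  have -> : (fun k => 'C(k, 0)%:R * b k) = (fun k => k%:R ^+ 0 * b k).
    by apply/funext => k; rewrite bin0 expr0.
  by split; [exact: db|exact: mb].
pose b' k := k%:R * b k - i%:R * b k.
have [|db' mb'] := ih b'.
  have b'E j : (fun k => k%:R ^+ j * b' k) =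
    (fun k => k%:R ^+ j.+1 * b k - i%:R * (k%:R ^+ j * b k)).
    by apply/funext => k; rewrite /b' exprSr; ring.
  split => j; rewrite b'E.
    by apply: geo_dominatedB => //; exact: geo_dominatedZ.
  have a1 := geo_dominated_asum s01 (db j.+1).
  have a2 := geo_dominated_asum s01 (db j).
  by rewrite csumB ?csumZ ?mb ?mulr0 ?subrr//; exact: asumZ.
have bE : (fun k => 'C(k, i.+1)%:R * b k) =
          (fun k => i.+1%:R^-1 * ('C(k, i)%:R * b' k)).
  apply/funext => k; apply: (@mulfI _ (i.+1%:R)); first by rewrite pnatr_eq0.
  rewrite mulrA -natrM mul_bin_left mulVKf ?pnatr_eq0// /b' -mulrBl.
  have [ik|ki] := leqP i k; first by rewrite natrM natrB//; ring.
  by rewrite bin_small// muln0 !mul0r.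
rewrite bE; split; first exact: geo_dominatedZ.
by rewrite csumZ ?mb' ?mulr0//; exact: geo_dominated_asum db'.
Qed.

Lemma binomial_partialS (y : R) k n :
  \sum_(i < n.+1) 'C(k.+1, i)%:R * y ^+ i =
  \sum_(i < n.+1) 'C(k, i)%:R * y ^+ i + y * \sum_(i < n) 'C(k, i)%:R * y ^+ i.
Proof.
rewrite !big_ord_recl !bin0 -addrA; congr (_ + _).
rewrite mulr_sumr -big_split; apply: eq_bigr => i _ /=.
by rewrite /bump/= add1n binS natrD exprS; ring.
Qed.

(** The recursion R(k+1, n+1) = R(k, n+1) - x R(k, n) of the remainders is
    solved with equality by the right-hand side, with x in place of - x. *)
Lemma binomial_remainder x k n : 0 <= x <= 1 ->
  `|(1 - x) ^+ k - \sum_(i < n) 'C(k, i)%:R * (- x) ^+ i|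
    <= 2^-1 ^+ n * (1 + 2 * x) ^+ k.
Proof.
move=> /andP[x0 x1]; elim: k n => [|k ih] [|n].
- by rewrite big_ord0 subr0 !expr0 mulr1 normr1.
- rewrite big_ord_recl bin0 !expr0 !mulr1 big1 ?addr0 ?subrr ?normr0.
    by rewrite exprn_ge0// invr_ge0.
  by move=> i _; rewrite lift0 bin0n mul0r.
- rewrite big_ord0 subr0 expr0 mul1r ger0_norm ?exprn_ge0 ?subr_ge0//.
  by rewrite lerXn2r ?nnegrE//; lra.
- rewrite binomial_partialS.
  set A := \sum_(i < n.+1) _; set B := \sum_(i < n) _.
  have -> : (1 - x) ^+ k.+1 - (A + - x * B) =
            ((1 - x) ^+ k - A) - x * ((1 - x) ^+ k - B) by rewrite exprS; ring.
  apply: (le_trans (ler_normB _ _)); rewrite normrM (ger0_norm x0).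
  apply: (le_trans (lerD (ih n.+1) (ler_wpM2l x0 (ih n)))).
  by rewrite !exprS le_eqVlt; apply/orP; left; apply/eqP; field.
Qed.

Lemma csum_binomial_partial sigma b (y : R) n : 0 <= sigma < 1 ->
  smooth_moments sigma b ->
  asum (fun k => (\sum_(i < n) 'C(k, i)%:R * y ^+ i)%:C * b k) /\
  csum (fun k => (\sum_(i < n) 'C(k, i)%:R * y ^+ i)%:C * b k) = 0.
Proof.
move=> s01 mb; elim: n => [|n [ih1 ih2]].
  have -> : (fun k => (\sum_(i < 0) 'C(k, i)%:R * y ^+ i)%:C * b k) =
            (fun k => 0).
    by apply/funext => k; rewrite big_ord0 mul0r.
  by split; [exact: (@asum_single _ _ 0)|rewrite (@csum_single _ _ 0)].
have -> : (fun k => (\sum_(i < n.+1) 'C(k, i)%:R * y ^+ i)%:C * b k) =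
  (fun k => (\sum_(i < n) 'C(k, i)%:R * y ^+ i)%:C * b k +
            (y ^+ n)%:C * ('C(k, n)%:R * b k)).
  apply/funext => k; rewrite big_ord_recr/= rmorphD rmorphM rmorph_nat; ring.
have [db mb0] := smooth_moments_bin n s01 mb.
have ab := geo_dominated_asum s01 db.
split; first by apply: asumD => //; exact: asumZ.
by rewrite csumD ?csumZ ?mb0 ?ih2 ?mulr0 ?addr0//; exact: asumZ.
Qed.

Lemma le0_geo (a C q : R) : 0 <= q < 1 -> (forall n, a <= q ^+ n * C) -> a <= 0.
Proof.
move=> q01 h; rewrite leNgt; apply/negP => a0.
have [N /(_ N (leqnn N))] := natrX_geo_small C 0 q01 a0.
by rewrite expr0 mul1r mulrC ltNge h.
Qed.

(** A step of analytic continuation along a segment: the Taylor coefficients of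
    t |-> sum b_k t^k at t = 1 are the binomial moments, which vanish, and the
    expansion represents the function at t = 1 - x. *)
Lemma smooth_moments_shift sigma x b : 0 <= sigma -> 0 <= x <= 1 ->
  sigma * (1 + 2 * x) < 1 -> smooth_moments sigma b ->
  smooth_moments sigma (fun k => (1 - x)%:C ^+ k * b k).
Proof.
move=> s0 /[dup] x01 /andP[x0 x1] sx mb.
have s01 : 0 <= sigma < 1.
  by rewrite s0/= (le_lt_trans _ sx)// ler_peMr// lerDl mulr_ge0.
have ncx k : nc ((1 - x)%:C ^+ k) <= 1.
  rewrite ncX nc_real exprn_ile1 ?normr_ge0//.
  by rewrite ger0_norm ?subr_ge0// gerBl.
have jE j : (fun k => k%:R ^+ j * ((1 - x)%:C ^+ k * b k)) =
            (fun k => (1 - x)%:C ^+ k * (k%:R ^+ j * b k)).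
  by apply/funext => k; ring.
have dom u : geo_dominated sigma u ->
    geo_dominated sigma (fun k => (1 - x)%:C ^+ k * u k).
  by move=> [M HM]; exists M => k; rewrite ncM (le_trans _ (HM k))// ler_piMl// nc_ge0.
split => j; rewrite jE; first by apply: dom; exact: mb.1.
have {mb} mb : smooth_moments sigma (fun k => k%:R ^+ j * b k).
  have E i : (fun k => k%:R ^+ i * (k%:R ^+ j * b k)) =
             (fun k => k%:R ^+ (i + j) * b k).
    by apply/funext => k; rewrite exprD mulrA.
  by split => i; rewrite E; [exact: mb.1|exact: mb.2].
suff H u : smooth_moments sigma u -> csum (fun k => (1 - x)%:C ^+ k * u k) = 0.
  exact: H mb.
move=> mu.
have [M HM] : geo_dominated sigma u.
  have [M HM] := mu.1 0; exists M => k; have := HM k.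
  by rewrite expr0 mul1r.
have au : asum (fun k => (1 - x)%:C ^+ k * u k).
  by apply: (geo_dominated_asum s01); apply: dom; exists M.
apply/eqP; rewrite -nc_eq0 eq_le nc_ge0 andbT.
pose g k := M * (sigma * (1 + 2 * x)) ^+ k.
have cg : cvgn (series g).
  by apply: geo_cvg; rewrite sx andbT mulr_ge0// addr_ge0// mulr_ge0.
apply: (@le0_geo _ (limn (series g)) 2^-1) => [|n]; first lra.
have [an sn] := csum_binomial_partial (- x) n s01 mu.
rewrite -[csum _]subr0 -sn -csumB//.
have -> : 2^-1 ^+ n * limn (series g) = limn (series (2^-1 ^+ n *: g)).
  by rewrite (@lim_seriesZ _ g (2^-1 ^+ n) cg).
apply: nc_csum; last exact: is_cvg_seriesZ.
move=> k; rewrite -mulrBl ncM -rmorphXn -rmorphB nc_real.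
have -> : (2^-1 ^+ n *: g) k = (2^-1 ^+ n * (1 + 2 * x) ^+ k) * (M * sigma ^+ k).
  by rewrite /g /GRing.scale/= /GRing.scale/= exprMn; ring.
by apply: ler_pM => //; [exact: nc_ge0|exact: binomial_remainder].
Qed.

(** Iterating the continuation step gives sum b_k t^k = 0 along a sequence
    t -> 0, so that the first nonzero b_k would have to be 0. *)
Lemma smooth_moments_eq0 sigma b : 0 <= sigma < 1 -> smooth_moments sigma b ->
  forall k, b k = 0.
Proof.
move=> /[dup] s01 /andP[s0 s1] mb p.
(* A step x small enough for sigma (1 + 2 x) < 1. *)
pose x := (1 - sigma) / 3.
have x01 : 0 < x < 1 by rewrite /x; lra.
have [x0 x1] := andP x01.
have sx : sigma * (1 + 2 * x) < 1 by rewrite /x; nra.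
have mbm m : smooth_moments sigma (fun k => (1 - x)%:C ^+ (m * k) * b k).
  elim: m => [|m ih].
    by under eq_fun do rewrite mul0n expr0 mul1r.
  have -> : (fun k => (1 - x)%:C ^+ (m.+1 * k) * b k) =
            (fun k => (1 - x)%:C ^+ k * ((1 - x)%:C ^+ (m * k) * b k)).
    by apply/funext => k; rewrite mulSn exprD mulrA.
  by apply: smooth_moments_shift => //; rewrite !ltW.
have ab : asum b.
  apply: (geo_dominated_asum s01); have [M HM] := mb.1 0; exists M => k.
  by have := HM k; rewrite expr0 mul1r.
elim/ltn_ind : p => p ih.
pose q := 1 - x.
have q01 : 0 <= q < 1 by rewrite /q; lra.
apply/eqP; rewrite -nc_eq0 eq_le nc_ge0 andbT.
(* As the terms before b_p vanish, sum b_k q^(m k) = 0 bounds b_p q^(m p) by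
   q^(m (p + 1)) times the sum of the |b_k|. *)
apply: (@le0_geo _ (limn (series (fun k => nc (b k)))) q) => // m.
have : csum (fun k => q%:C ^+ (m * k) * b k) = 0.
  rewrite -[RHS]((mbm m).2 0); congr csum; apply/funext => k.
  by rewrite expr0 mul1r.
pose u k := if k == p then q%:C ^+ (m * k) * b k else 0.
pose v k := if k == p then 0 else q%:C ^+ (m * k) * b k.
have vb k : nc (v k) <= q ^+ (m * p.+1) * nc (b k).
  rewrite /v; case: ltngtP => kp.
  - by rewrite ih// mulr0 nc0 mulr0.
  - rewrite ncM ncX nc_real ger0_norm; last by case/andP: q01.
    rewrite ler_wpM2r ?nc_ge0// ler_wiXn2l ?leq_mul2l ?kp ?orbT//.
      by case/andP: q01.
    by case/andP: q01 => _ /ltW.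
  - by rewrite nc0 mulr_ge0 ?nc_ge0// exprn_ge0//; case/andP: q01.
have cb : cvgn (series (fun k => q ^+ (m * p.+1) * nc (b k))).
  exact: (@is_cvg_seriesZ _ (fun k => nc (b k)) (q ^+ (m * p.+1))).
have -> : (fun k => q%:C ^+ (m * k) * b k) = (fun k => u k + v k).
  by apply/funext => k; rewrite /u /v; case: ifPn; rewrite ?addr0 ?add0r.
have u0 k : k != p -> u k = 0 by rewrite /u => /negbTE ->.
rewrite csumD; last 2 first.
- exact: asum_single u0.
- exact: asum_le cb.
rewrite (csum_single u0) {1}/u eqxx => /eqP; rewrite addr_eq0 => /eqP/(congr1 nc).
rewrite ncN ncM ncX nc_real ger0_norm; last by case/andP: q01.
have := nc_csum vb cb.
rewrite (@lim_seriesZ _ (fun k => nc (b k)) (q ^+ (m * p.+1)))// => h E.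
rewrite -E /GRing.scale/= mulnS exprD -mulrA [in leRHS]mulrCA in h.
by move: h; rewrite ler_pM2l// exprn_gt0//; rewrite /q; lra.
Qed.

End VanishingMoments.

(** * Euler iterates of a power series *)

Section WeightedPowerSeries.
Context {R : realType}.
Implicit Types (c : nat -> R[i]) (z y : R[i]) (s t M : R).

Definition coef_bound t M c := forall k, nc (c k) * t ^+ k <= M.

Definition tame c := forall t : R, 0 < t < 1 -> exists M, coef_bound t M c.

(** The j-th iterate of the Euler operator z d/dz applied to the power series
    with coefficients c.  At a point other than 0 these iterates vanish to the
    same order as the derivatives do, and they keep the index of every
    coefficient in place. *)
Definition euler j c z := csum (fun k => k%:R ^+ j * c k * z ^+ k).

(** The derivative of [euler j c]; the term of index 0 vanishes thanks to the
    positive power of k. *)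
Definition deuler j c z := csum (fun k => k%:R ^+ j.+1 * c k * z ^+ k.-1).

(** A bound of [euler j c] on the disk of radius s, uniform over the sequences c
    such that [coef_bound t M c]. *)
Definition majorant j s t M := limn (series (fun k => M * (k%:R ^+ j * (s / t) ^+ k))).

Lemma power_seriesE c : power_series c = euler 0 c.
Proof.
apply/funext => z; rewrite /power_series /euler /csum.
by under [in RHS]eq_fun do rewrite expr0 mul1r.
Qed.

Lemma coef_bound_le t t' M c : 0 <= t' <= t -> coef_bound t M c -> coef_bound t' M c.
Proof.
move=> /andP[t0 tt] h k; apply: le_trans (h k).
by rewrite ler_wpM2l ?nc_ge0// lerXn2r// nnegrE (le_trans t0).
Qed.

Lemma coef_bound_nat t M c : 0 <= M -> coef_bound t M c ->
  exists n : nat, coef_bound t n%:R c.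
Proof.
move=> M0 cM; exists (Num.bound M) => k.
by apply: le_trans (cM k) _; exact/ltW/archi_boundP.
Qed.

Lemma coef_bound_eventually t N c : 0 <= t ->
  (forall k, (N <= k)%N -> nc (c k) * t ^+ k <= 1) ->
  exists2 M, 0 <= M & coef_bound t M c.
Proof.
move=> t0 hN.
have ge0 k : 0 <= nc (c k) * t ^+ k by rewrite mulr_ge0 ?nc_ge0 ?exprn_ge0.
exists (1 + \sum_(k < N) nc (c k) * t ^+ k) => [|k].
  by rewrite addr_ge0// sumr_ge0.
have [kN|Nk] := ltnP k N.
  rewrite (bigD1 (Ordinal kN))//= addrCA lerDl.
  by apply: addr_ge0 => //; apply: sumr_ge0.
by rewrite -[leLHS]addr0; apply: lerD; [exact: hN|apply: sumr_ge0].
Qed.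

Lemma ratio01 s t : 0 <= s < t -> 0 <= s / t < 1.
Proof.
move=> /andP[s0 st]; have t0 : 0 < t by exact: le_lt_trans st.
by apply/andP; split; [rewrite divr_ge0// ltW|rewrite ltr_pdivrMr// mul1r].
Qed.

Section Bounds.
Variables (s t M : R) (c : nat -> R[i]).
Hypotheses (st : 0 < s < t) (cM : coef_bound t M c).

Let s0 : 0 < s. Proof. by case/andP: st. Qed.
Let t0 : 0 < t. Proof. by case/andP: st => sp /(lt_trans sp). Qed.
Let st1 : 0 <= s / t < 1.
Proof. by apply: ratio01; case/andP: st => /ltW -> ->. Qed.

Lemma coef_bound_ge0 : 0 <= M.
Proof. by apply: le_trans (cM 0); rewrite expr0 mulr1 nc_ge0. Qed.

Lemma majorant_cvg j : cvgn (series (fun k => M * (k%:R ^+ j * (s / t) ^+ k))).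
Proof. exact: natrX_geo_cvg. Qed.
Arguments majorant_cvg : clear implicits.

Lemma majorantZ j (w : R) : majorant j s t M * w =
  limn (series (w *: (fun k => M * (k%:R ^+ j * (s / t) ^+ k)))).
Proof.
by rewrite (@lim_seriesZ _ (fun k => _) w (majorant_cvg j)) /GRing.scale/= mulrC.
Qed.

Lemma majorant_ge0 j : 0 <= majorant j s t M.
Proof.
have h k : nc ((fun=> 0) k : R[i]) <= M * (k%:R ^+ j * (s / t) ^+ k).
  by rewrite nc0 mulr_ge0 ?coef_bound_ge0// mulr_ge0 ?exprn_ge0//; case/andP: st1.
by apply: le_trans (nc_csum h (majorant_cvg j)); exact: nc_ge0.
Qed.

Lemma coef_weight_le j k (r : R) : r <= s ^+ k ->
  k%:R ^+ j * nc (c k) * r <= M * (k%:R ^+ j * (s / t) ^+ k).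
Proof.
move=> rs; rewrite [leRHS]mulrCA -mulrA ler_wpM2l ?exprn_ge0//.
apply: (@le_trans _ _ (nc (c k) * s ^+ k)); first by rewrite ler_wpM2l ?nc_ge0.
have -> : nc (c k) * s ^+ k = (nc (c k) * t ^+ k) * (s / t) ^+ k.
  by rewrite -mulrA -exprMn [t * _]mulrC divfK ?gt_eqF.
by rewrite ler_wpM2r// exprn_ge0//; case/andP: st1.
Qed.

Lemma nc_weighted j k z : nc (k%:R ^+ j * c k * z) = k%:R ^+ j * nc (c k) * nc z.
Proof. by rewrite !ncM ncX nc_nat. Qed.

Lemma euler_term_le j z k : nc z <= s ->
  nc (k%:R ^+ j * c k * z ^+ k) <= M * (k%:R ^+ j * (s / t) ^+ k).
Proof.
move=> zs; rewrite nc_weighted coef_weight_le// ncX lerXn2r// nnegrE ?nc_ge0//.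
exact: ltW.
Qed.

Lemma euler_asum j z : nc z <= s -> asum (fun k => k%:R ^+ j * c k * z ^+ k).
Proof.
by move=> zs; apply: asum_le (majorant_cvg j) => k; exact: euler_term_le.
Qed.

Lemma deuler_term_le j z k : nc z <= s ->
  nc (k%:R ^+ j.+1 * c k * z ^+ k.-1) <= s^-1 * (M * (k%:R ^+ j.+1 * (s / t) ^+ k)).
Proof.
move=> zs; rewrite -ler_pdivrMl ?invr_gt0// invrK nc_weighted.
case: k => [|k] /=.
  by rewrite exprS !(mul0r, mulr0).
rewrite mulrC -[leLHS]mulrA coef_weight_le// exprSr ler_wpM2r ?(ltW s0)//.
by rewrite ncX lerXn2r// nnegrE ?nc_ge0// ltW.
Qed.

Lemma deuler_asum j z : nc z <= s ->
  asum (fun k => k%:R ^+ j.+1 * c k * z ^+ k.-1).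
Proof.
move=> zs.
apply: (@asum_le _ _ (s^-1 *: (fun k => M * (k%:R ^+ j.+1 * (s / t) ^+ k)))) => [k|].
  exact: deuler_term_le.
exact/is_cvg_seriesZ/majorant_cvg.
Qed.

Lemma mul_deuler j z : nc z <= s -> z * deuler j c z = euler j.+1 c z.
Proof.
move=> zs; rewrite -csumZ; last exact: deuler_asum.
congr csum; apply/funext => -[|k] /=; first by rewrite exprS !(mul0r, mulr0).
by rewrite [z ^+ k.+1]exprS; ring.
Qed.

Lemma powers_lipschitz z y k : nc z <= s -> nc y <= s ->
  nc (z ^+ k - y ^+ k) <= k%:R * s ^+ k * (nc (z - y) / s).
Proof.
move=> zs ys; elim: k => [|k ih]; first by rewrite !expr0 subrr nc0 !mul0r.
have -> : z ^+ k.+1 - y ^+ k.+1 = z * (z ^+ k - y ^+ k) + y ^+ k * (z - y).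
  by rewrite !exprS; ring.
apply: (le_trans (ncD _ _)); rewrite !ncM.
have -> : k.+1%:R * s ^+ k.+1 * (nc (z - y) / s) =
   s * (k%:R * s ^+ k * (nc (z - y) / s)) + s ^+ k * nc (z - y).
  by rewrite -natr1 exprS; field; rewrite gt_eqF.
apply: lerD; first by apply: ler_pM => //; exact: nc_ge0.
by rewrite ler_wpM2r ?nc_ge0// ncX lerXn2r// nnegrE ?nc_ge0// ltW.
Qed.

(** The remainder T_k of the first-order expansion satisfies
    T_k+1 = z T_k + k y^(k-1) (z - y)^2. *)
Lemma powers_taylor z y k : nc z <= s -> nc y <= s ->
  nc (z ^+ k - y ^+ k - (z - y) * (k%:R * y ^+ k.-1))
    <= k%:R ^+ 2 * s ^+ k * (nc (z - y) / s) ^+ 2.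
Proof.
move=> zs ys; elim: k => [|k ih].
  by rewrite !expr0 subrr mul0r mulr0 subrr nc0 expr0n/= !mul0r.
have -> : z ^+ k.+1 - y ^+ k.+1 - (z - y) * (k.+1%:R * y ^+ k.+1.-1) =
   z * (z ^+ k - y ^+ k - (z - y) * (k%:R * y ^+ k.-1))
   + k%:R * y ^+ k.-1 * (z - y) ^+ 2.
  case: k {ih} => [|k] /=; first by rewrite !expr0 expr1; ring.
  by rewrite -[k.+2%:R]natr1 !exprS; ring.
apply: (le_trans (ncD _ _)); rewrite ncM.
set d := nc (z - y).
apply: (@le_trans _ _ (s * (k%:R ^+ 2 * s ^+ k * (d / s) ^+ 2) +
                       k%:R * s ^+ k.+1 * (d / s) ^+ 2)).
  apply: lerD; first by apply: ler_pM => //; exact: nc_ge0.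
  rewrite !ncM nc_nat ncX.
  case: k {ih} => [|k] /=; first by rewrite !mul0r.
  have -> : k.+1%:R * s ^+ k.+2 * (d / s) ^+ 2 = k.+1%:R * s ^+ k * (d * d).
    by rewrite !exprS expr0; field; rewrite gt_eqF.
  rewrite -/d ler_wpM2r ?mulr_ge0 ?nc_ge0// ler_wpM2l//.
  by rewrite lerXn2r// nnegrE ?nc_ge0// ltW.
rewrite [leLHS](_ : _ = (k%:R ^+ 2 + k%:R) * (s ^+ k.+1 * (d / s) ^+ 2)).
  rewrite -[leRHS]mulrA ler_wpM2r ?mulr_ge0 ?exprn_ge0 ?divr_ge0 ?nc_ge0 ?invr_ge0 ?(ltW s0)//.
  by rewrite -natr1 !expr2; have := ler0n R k; nra.
by rewrite [s ^+ k.+1]exprS; ring.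
Qed.

Lemma euler_lipschitz j z y : nc z <= s -> nc y <= s ->
  nc (euler j c z - euler j c y) <= majorant j.+1 s t M * (nc (z - y) / s).
Proof.
move=> zs ys; rewrite -csumB; [|exact: euler_asum..].
rewrite majorantZ.
apply: nc_csum; last exact/is_cvg_seriesZ/majorant_cvg.
move=> k; rewrite -mulrBr nc_weighted.
apply: (@le_trans _ _ (k%:R ^+ j * nc (c k) * (k%:R * s ^+ k * (nc (z - y) / s)))).
  by rewrite ler_wpM2l ?powers_lipschitz// mulr_ge0 ?exprn_ge0 ?nc_ge0.
rewrite /GRing.scale/= [leRHS]mulrC.
rewrite [leLHS](_ : _ = k%:R ^+ j.+1 * nc (c k) * s ^+ k * (nc (z - y) / s)).
  by rewrite ler_wpM2r ?coef_weight_le// divr_ge0 ?nc_ge0// ltW.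
by rewrite exprS; ring.
Qed.

Lemma euler_taylor j z y : nc z <= s -> nc y <= s ->
  nc (euler j c z - euler j c y - (z - y) * deuler j c y)
    <= majorant j.+2 s t M * (nc (z - y) / s) ^+ 2.
Proof.
move=> zs ys.
have az := @euler_asum j z zs; have ay := @euler_asum j y ys.
have ad := @deuler_asum j y ys.
rewrite -csumB// -csumZ// -csumB; [|exact: asumB|exact: asumZ].
rewrite majorantZ.
apply: nc_csum; last exact/is_cvg_seriesZ/majorant_cvg.
move=> k.
have -> : k%:R ^+ j * c k * z ^+ k - k%:R ^+ j * c k * y ^+ k -
          (z - y) * (k%:R ^+ j.+1 * c k * y ^+ k.-1) =
   k%:R ^+ j * c k * (z ^+ k - y ^+ k - (z - y) * (k%:R * y ^+ k.-1)).
  by rewrite exprS; ring.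
rewrite nc_weighted.
apply: (@le_trans _ _ (k%:R ^+ j * nc (c k) *
                       (k%:R ^+ 2 * s ^+ k * (nc (z - y) / s) ^+ 2))).
  by rewrite ler_wpM2l ?powers_taylor// mulr_ge0 ?exprn_ge0 ?nc_ge0.
rewrite /GRing.scale/= [leRHS]mulrC.
rewrite [leLHS](_ : _ = k%:R ^+ j.+2 * nc (c k) * s ^+ k * (nc (z - y) / s) ^+ 2).
  by rewrite ler_wpM2r ?coef_weight_le// exprn_ge0// divr_ge0 ?nc_ge0// ltW.
by rewrite !exprS; ring.
Qed.

End Bounds.

(** Two distinct radii between r and 1: the inner one bounds points, the outer
    one bounds coefficients. *)
Lemma radii_between (r : R) : 0 <= r < 1 ->
  exists s t, [/\ r < s, 0 < s < t & 0 < t < 1].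
Proof.
move=> /andP[r0 r1]; exists ((2 * r + 1) / 3), ((r + 2) / 3); split; last 2 first.
- by apply/andP; split; lra.
- by apply/andP; split; lra.
- by lra.
Qed.

Lemma tame_euler_asum j c z : tame c -> nc z < 1 ->
  asum (fun k => k%:R ^+ j * c k * z ^+ k).
Proof.
move=> tc z1; have [|s [t [zs st /tc[M cM]]]] := @radii_between (nc z).
  by rewrite nc_ge0.
by exact: (euler_asum st cM (ltW zs)).
Qed.

Lemma tame_is_derive c z : tame c -> nc z < 1 ->
  is_derive z 1 (power_series c) (deuler 0 c z).
Proof.
move=> tc z1; have [|s [t [zs st /tc[M cM]]]] := @radii_between (nc z).
  by rewrite nc_ge0.
have [s0 _] := andP st.
pose C := majorant 2 s t M / s ^+ 2.
have C0 : 0 <= C by rewrite divr_ge0 ?exprn_ge0 ?(ltW s0)//; exact: majorant_ge0 cM _.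
suff h : (fun h => h^-1 *: ((power_series c \o shift z) (h *: (1 : R[i])) - power_series c z))
    @ 0^' --> deuler 0 c z.
  by apply: DeriveDef; [apply/cvg_ex; eexists; exact: h|exact/cvg_lim].
apply/cvgrPdist_lt => -[e e']; rewrite ltcE/= => /andP[/eqP -> e0].
have d0 : 0 < Num.min (s - nc z) (e / (C + 1)).
  by rewrite lt_min subr_gt0 zs divr_gt0// ltr_wpDl.
apply/nbhs_ballP; exists ((Num.min (s - nc z) (e / (C + 1)))%:C) => /=.
  by rewrite ltcR.
move=> h; rewrite /ball/= sub0r normrN normrc ltcR lt_min => /andP[h1 h2] hn0.
rewrite normrc ltcR power_seriesE /= /GRing.scale/= mulr1.
have zhs : nc (h + z) <= s.
  by rewrite (le_trans (ncD _ _))// -lerBrDr ltW.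
have := euler_taylor st cM 0 zhs (ltW zs).
rewrite addrK => hT.
rewrite nc_distC.
have -> : h^-1 * (euler 0 c (h + z) - euler 0 c z) - deuler 0 c z =
          h^-1 * (euler 0 c (h + z) - euler 0 c z - h * deuler 0 c z).
  by rewrite [RHS]mulrBr mulKf.
rewrite ncM ncV mulrC ltr_pdivrMr ?nc_gt0//.
apply: (le_lt_trans hT).
have nh0 : 0 < nc h by rewrite nc_gt0.
rewrite [ltLHS](_ : _ = (C * nc h) * nc h); last first.
  by rewrite /C; field; rewrite gt_eqF.
rewrite ltr_pM2r//; apply: (@le_lt_trans _ _ ((C + 1) * nc h)).
  by rewrite ler_wpM2r ?nc_ge0// lerDl.
by rewrite mulrC -ltr_pdivlMr// ltr_wpDl.
Qed.

Lemma tame_derive c z : tame c -> nc z < 1 ->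
  derive1 (power_series c) z = deuler 0 c z.
Proof. by move=> tc z1; rewrite derive1E; have [_ ->] := tame_is_derive tc z1. Qed.

Lemma unit_diskE z : unit_disk z <-> nc z < 1.
Proof. by rewrite /unit_disk/= normrc -(ltcR (nc z) 1). Qed.

(** Convergence at the point t bounds the terms there; conversely such bounds
    give absolute convergence and the derivative at every smaller radius. *)
Lemma analytic_tame c : analytic_power_series c <-> tame c.
Proof.
split=> [ac t /andP[t0 t1]|tc z /unit_diskE z1].
  have /ac[/cvg_series_cvg_0] : unit_disk t%:C.
    by apply/unit_diskE; rewrite nc_real ger0_norm// ltW.
  move=> /cvg_ncP/(_ 1 ltr01)[N HN] _.
  have [|M _ cM] := @coef_bound_eventually t N c (ltW t0); last by exists M.
  move=> k /HN; rewrite sub0r ncN ncM ncX nc_real ger0_norm; last exact: ltW.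
  exact: ltW.
split; last by have [] := tame_is_derive tc z1.
have := csum_cvg (@tame_euler_asum 0 c z tc z1).
by under eq_fun do rewrite expr0 mul1r; move=> h; apply/cvg_ex; eexists; exact: h.
Qed.

Lemma euler_at0 c : euler 0 c 0 = c 0.
Proof.
rewrite /euler (@csum_single _ _ 0) ?expr0 ?mul1r ?mulr1//.
by move=> k k0; rewrite [0 ^+ k]expr0n (negbTE k0) mulr0.
Qed.

Lemma deuler_at0 c : deuler 0 c 0 = c 1.
Proof.
rewrite /deuler (@csum_single _ _ 1) /= ?expr0 ?expr1 ?mul1r ?mulr1//.
by move=> [|[|k]] k0 //=; rewrite ?expr1 ?mul0r// [0 ^+ _]expr0n mulr0.
Qed.

(** If all the iterates vanish at z, then the sequence c_k z^k has vanishing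
    moments and is 0 by [smooth_moments_eq0]; otherwise the first iterate that
    does not vanish has index j + 2 for some j. *)
Lemma finite_order c z : tame c -> nc z < 1 -> z != 0 ->
  euler 0 c z = 0 -> euler 1 c z = 0 ->
  (forall k, c k = 0) \/
  exists j, [/\ euler j c z = 0, euler j.+1 c z = 0 & euler j.+2 c z != 0].
Proof.
move=> tc z1 z0 e0 e1.
have [[n en]|all0] := pselect (exists n, euler n c z != 0); last first.
  left => k; have [|s [t [zs st /tc[M cM]]]] := @radii_between (nc z).
    by rewrite nc_ge0.
  have st1 : 0 <= s / t < 1 by apply: ratio01; case/andP: st => /ltW -> ->.
  have [sigma0 sigma1] := andP st1.
  pose sigma := (s / t + 1) / 2.
  have sg : s / t < sigma by rewrite /sigma; lra.
  have sg01 : 0 <= sigma < 1 by apply/andP; split; rewrite /sigma; lra.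
  have jE j : (fun k => k%:R ^+ j * (c k * z ^+ k)) =
              (fun k => k%:R ^+ j * c k * z ^+ k).
    by apply/funext => ?; rewrite mulrA.
  have : smooth_moments sigma (fun k => c k * z ^+ k).
    split => j; rewrite jE.
      have [|C C0 HC] := @natrX_geo R j (s / t) sigma; first by rewrite sigma0.
      exists (M * C) => i; apply: (le_trans (euler_term_le st cM j i (ltW zs))).
      by rewrite -mulrA ler_wpM2l// (coef_bound_ge0 cM).
    by apply: contrapT => /eqP h; apply: all0; exists j.
  move=> /(smooth_moments_eq0 sg01)/(_ k)/eqP.
  by rewrite mulf_eq0 expf_eq0 (negbTE z0) andbF orbF => /eqP.
right; have exn : exists n, euler n c z != 0 by exists n.
case: (ex_minnP exn) => -[|[|j]] ej jmin.
- by rewrite e0 eqxx in ej.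
- by rewrite e1 eqxx in ej.
- exists j; split => //; apply/eqP; apply: contraT => /jmin.
    by rewrite ltnNge leqW.
  by rewrite ltnn.
Qed.

End WeightedPowerSeries.

(** * Rigidity of double zeros under exchange of coefficients *)

Section SwapRigidity.
Context {R : realType}.
Implicit Types (c : nat -> R[i]) (z : R[i]).

Definition swap N k := if k == N then N.+1 else if k == N.+1 then N else k.

Lemma swapK N : involutive (swap N).
Proof.
move=> k; rewrite /swap; case: (eqVneq k N) => [->|kN].
  by rewrite eqxx (gtn_eqF (ltnSn N)).
by case: (eqVneq k N.+1) => [->|kN1]; rewrite ?eqxx// (negbTE kN) (negbTE kN1).
Qed.

Lemma swapl N : swap N N = N.+1. Proof. by rewrite /swap eqxx. Qed.

Lemma swapr N : swap N N.+1 = N.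
Proof. by rewrite /swap eqxx (gtn_eqF (ltnSn N)). Qed.

Lemma swap_id N k : k != N -> k != N.+1 -> swap N k = k.
Proof. by rewrite /swap => /negbTE -> /negbTE ->. Qed.

Lemma euler_swap j N c z :
  asum (fun k => k%:R ^+ j * c k * z ^+ k) ->
  asum (fun k => k%:R ^+ j * c (swap N k) * z ^+ k) ->
  euler j (c \o swap N) z - euler j c z =
  (c N.+1 - c N) * (N%:R ^+ j * z ^+ N - N.+1%:R ^+ j * z ^+ N.+1).
Proof.
move=> ac ac'; rewrite -csumB//.
pose u k := if k == N then N%:R ^+ j * z ^+ N * (c N.+1 - c N) else 0.
pose v k := if k == N.+1 then N.+1%:R ^+ j * z ^+ N.+1 * (c N - c N.+1) else 0.
have -> : (fun k => k%:R ^+ j * (c \o swap N) k * z ^+ k - k%:R ^+ j * c k * z ^+ k)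
          = (fun k => u k + v k).
  apply/funext => k; rewrite /u /v /=; case: (eqVneq k N) => [->|kN].
    by rewrite (ltn_eqF (ltnSn N)) swapl addr0; ring.
  case: (eqVneq k N.+1) => [->|kN1]; first by rewrite swapr add0r; ring.
  by rewrite swap_id// subrr addr0.
have u0 k : k != N -> u k = 0 by rewrite /u => /negbTE ->.
have v0 k : k != N.+1 -> v k = 0 by rewrite /v => /negbTE ->.
rewrite csumD; [|exact: asum_single u0|exact: asum_single v0].
rewrite (csum_single u0) (csum_single v0) /u /v !eqxx.
by set A := N%:R ^+ j * _; set B := N.+1%:R ^+ j * _; ring.
Qed.

Lemma bernoulli (x : R) j : 0 <= x <= 1 -> 1 - j%:R * x <= (1 - x) ^+ j.
Proof.
move=> /andP[x0 x1]; elim: j => [|j ih]; first by rewrite mul0r subr0 expr0.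
have := ler_wpM2r (_ : 0 <= 1 - x) ih; rewrite subr_ge0 => /(_ x1).
rewrite exprSr; apply: le_trans; rewrite -natr1.
have : 0 <= j%:R * x * x by rewrite !mulr_ge0.
nra.
Qed.

Lemma succ_pow_ratio j (s : R) : 0 < s < 1 -> exists N0, forall N, (N0 <= N)%N ->
  N%:R ^+ j * ((1 - s) / 2) <= N%:R ^+ j - N.+1%:R ^+ j * s.
Proof.
move=> /andP[s0 s1].
pose N0 := Num.bound (2 * j%:R / (1 - s)).
have hN0 : 2 * j%:R / (1 - s) < N0%:R.
  by apply: le_lt_trans (archi_boundP _); rewrite ?divr_ge0 ?mulr_ge0// subr_ge0 ltW.
exists N0 => N N0N.
pose x : R := N.+1%:R^-1.
have x01 : 0 <= x <= 1.
  by rewrite /x invr_ge0 ler0n/= invf_le1 ?ltr0n// ler1n.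
have jx : j%:R * x <= (1 - s) / 2.
  rewrite /x ler_pdivrMr ?ltr0n//.
  have : N0%:R <= N.+1%:R :> R by rewrite ler_nat leqW.
  move=> /(lt_le_trans hN0); rewrite ltr_pdivrMr ?subr_gt0// => h.
  lra.
have := bernoulli j x01; move=> /(le_trans (lerB (lexx 1) jx)) h.
have Npos : 0 <= N.+1%:R ^+ j :> R by rewrite exprn_ge0.
have -> : N%:R ^+ j = N.+1%:R ^+ j * (1 - x) ^+ j :> R.
  rewrite -exprMn; congr (_ ^+ _); rewrite /x mulrBr mulr1 divff ?pnatr_eq0//.
  by rewrite -natr1 addrK.
have := ler_wpM2l Npos h.
set P := N.+1%:R ^+ j; set Q := (1 - x) ^+ j => h1.
have : 0 <= P * (1 - s) ^+ 2 by rewrite mulr_ge0// sqr_ge0.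
nra.
Qed.

(** Zeros of [euler j] that are double and uniformly nondegenerate cannot
    survive a transposition of two unequal neighbouring coefficients of large
    index.  Write x for the displacement of the zero and
    e (z^N - z^(N+1)) for the perturbation.  At the old zero the perturbed
    function is O(x^2) and its derivative is of order x, whereas the
    perturbation and its derivative there are of comparable size E up to powers
    of N; so E is at most of order N^m E^2, although E decays exponentially. *)
Lemma swap_rigidity j (s t M delta : R) : 0 < s < t -> t < 1 -> 0 < delta ->
  exists2 r0, 0 < r0 & exists N0, forall N c beta gamma, (N0 <= N)%N ->
    coef_bound t M c -> coef_bound t M (c \o swap N) ->
    nc beta <= s -> beta != 0 -> nc gamma <= s -> gamma != 0 ->
    nc (beta - gamma) <= r0 ->
    euler j c beta = 0 -> euler j.+1 c beta = 0 ->
    euler j (c \o swap N) gamma = 0 -> euler j.+1 (c \o swap N) gamma = 0 ->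
    delta <= nc (euler j.+2 (c \o swap N) gamma) ->
  c N = c N.+1.
Proof.
move=> st t1 delta0; have [s0 lst] := andP st.
have s1 : s < 1 by exact: lt_trans t1.
have t0 : 0 < t by exact: lt_trans lst.
(* K2 and K3 are the constants of the expansions of order two of [euler j] and
   [euler j.+1]; r0 is such that K3 x^2 is at most half of delta x. *)
pose K2 := majorant j.+2 s t M / s ^+ 2.
pose K3 := majorant j.+3 s t M / s ^+ 2.
pose K3' := Num.max K3 0.
have K3'0 : 0 <= K3' by rewrite /K3' le_max lexx orbT.
pose r0 := delta / (2 * (K3' + 1)).
have r00 : 0 < r0 by rewrite divr_gt0// mulr_gt0// ltr_wpDl.
exists r0 => //.
have [|N1 HN1] := @succ_pow_ratio j s; first by rewrite s0.
pose kappa := (1 - s) / 2.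
have kappa0 : 0 < kappa by rewrite /kappa; lra.
have st1 : 0 <= s / t < 1 by apply: ratio01; rewrite ltW.
(* Combining the estimates below gives
   kappa delta^2 <= 16 K2 E (N+1)^(2 (j+1)) with E <= 2 M (s/t)^N; the factor
   t / s makes N + 1 the exponent throughout. *)
have [|N2 HN2] := natrX_geo_small (32 * K2 * M * (t / s)) (j.+1 * 2) st1
    (_ : 0 < kappa * delta ^+ 2); first by rewrite mulr_gt0// exprn_gt0.
exists (maxn 1 (maxn N1 N2)) => N c b g; rewrite !geq_max => /and3P[N1' NN1 NN2].
set c' := c \o swap N => cM c'M bs bn0 gs gn0 bg.
move=> e0b e1b e0g e1g e2g; apply/eqP; apply/negPn/negP => cN.
pose e := c N.+1 - c N.
pose x := nc (b - g).
have x0 : 0 <= x by exact: nc_ge0.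
have K20 : 0 <= K2 by rewrite divr_ge0 ?exprn_ge0 ?(ltW s0)//; exact: majorant_ge0 cM _.
have K30 : 0 <= K3 by rewrite divr_ge0 ?exprn_ge0 ?(ltW s0)//; exact: majorant_ge0 cM _.
have dg0 : deuler j c' g = 0.
  apply/eqP; have := mul_deuler st c'M j gs.
  by rewrite e1g => /eqP; rewrite mulf_eq0 (negbTE gn0).
have dg1 : delta <= nc (deuler j.+1 c' g).
  apply: (le_trans e2g); rewrite -(mul_deuler st c'M j.+1 gs) ncM.
  by rewrite ler_piMl ?nc_ge0// (le_trans gs)// ltW.
have h1 : nc (euler j c' b) <= K2 * x ^+ 2.
  have := euler_taylor st c'M j bs gs; rewrite dg0 e0g mulr0 !subr0.
  by rewrite expr_div_n mulrA mulrAC.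
have h2 : x * (delta / 2) <= nc (euler j.+1 c' b).
  have := euler_taylor st c'M j.+1 bs gs; rewrite e1g subr0.
  rewrite expr_div_n mulrA mulrAC -/K3 -/x nc_distC => hT.
  have := le_trans (nc_subl _ _) hT; rewrite ncM -/x lerBlDr => hL.
  have hx : K3 * x <= delta / 2.
    have h3 : K3 * x <= K3' * r0.
      by apply: ler_pM => //; rewrite /K3' le_max lexx.
    apply: (le_trans h3); rewrite /r0 mulrA ler_pdivrMr ?mulr_gt0 ?ltr_wpDl//.
    nra.
  have := ler_wpM2l x0 dg1; have := ler_wpM2l x0 hx.
  rewrite expr2 in hL; nra.
pose E := nc e * nc b ^+ N.
have E0 : 0 < E by rewrite mulr_gt0 ?exprn_gt0 ?nc_gt0// subr_eq0 eq_sym.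
have Nc : asum (fun k => k%:R ^+ j * c (swap N k) * b ^+ k) by exact: (euler_asum st c'M bs).
have Nc1 : asum (fun k => k%:R ^+ j.+1 * c (swap N k) * b ^+ k) by exact: (euler_asum st c'M bs).
have h3 : E * kappa <= nc (euler j c' b).
  have := euler_swap (euler_asum st cM bs) Nc; rewrite e0b subr0 => ->.
  rewrite ncM -/e /E -mulrA ler_wpM2l ?nc_ge0//.
  apply: le_trans (nc_subl _ _); rewrite !ncM !ncX !nc_nat.
  have := HN1 N NN1; rewrite -/kappa => h.
  have bN : 0 <= nc b ^+ N by rewrite exprn_ge0// nc_ge0.
  have N1j : 1 <= N%:R ^+ j :> R by rewrite exprn_ege1// ler1n.
  apply: (@le_trans _ _ (nc b ^+ N * (N%:R ^+ j - N.+1%:R ^+ j * s))).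
    rewrite ler_wpM2l//; apply: le_trans h.
    by rewrite ler_peMl// ltW.
  rewrite exprS mulrBr [_ * N%:R ^+ j]mulrC lerD2l lerN2.
  rewrite mulrA mulrC ler_wpM2l// ler_wpM2l// exprn_ge0//.
have h4 : nc (euler j.+1 c' b) <= E * (2 * N.+1%:R ^+ j.+1).
  have := euler_swap (euler_asum st cM bs) Nc1; rewrite e1b subr0 => ->.
  rewrite ncM -/e /E -mulrA ler_wpM2l ?nc_ge0//.
  apply: (le_trans (ncB _ _)); rewrite !ncM !ncX !nc_nat.
  have bN : 0 <= nc b ^+ N by rewrite exprn_ge0// nc_ge0.
  rewrite mulrDl mul1r mulrDr; apply: lerD.
    by rewrite mulrC ler_wpM2l// lerXn2r ?nnegrE// ler_nat.
  rewrite mulrC ler_wpM2r ?exprn_ge0// exprS ler_piMl//.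
  by rewrite (le_trans bs)// ltW.
have hE : E <= 2 * M * (s / t) ^+ N.
  have he : nc e * t ^+ N <= 2 * M.
    apply: (@le_trans _ _ ((nc (c' N) + nc (c N)) * t ^+ N)).
      rewrite ler_wpM2r ?exprn_ge0 ?(ltW t0)//.
      by rewrite /e /c' /= swapl; exact: ncB.
    by rewrite mulrDl mulrDl mul1r lerD.
  rewrite expr_div_n mulrA ler_pdivlMr ?exprn_gt0//.
  rewrite /E mulrAC; apply: ler_pM => //.
  - by rewrite mulr_ge0 ?nc_ge0// exprn_ge0// ltW.
  - by rewrite exprn_ge0 ?nc_ge0.
  - by rewrite lerXn2r// nnegrE ?nc_ge0// ltW.
have := HN2 N.+1 (leqW NN2); apply/negP; rewrite -leNgt.
set L : R := N.+1%:R ^+ j.+1 in h4.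
have L0 : 0 <= L by rewrite exprn_ge0.
have h5 : x * (delta / 2) <= E * (2 * L) by exact: le_trans h2 h4.
have h6 : E * kappa <= K2 * x ^+ 2 by exact: le_trans h3 h1.
have h7 : (x * delta) ^+ 2 <= (4 * E * L) ^+ 2.
  have xd0 : 0 <= x * delta by rewrite mulr_ge0// ltW.
  have le : x * delta <= 4 * E * L by lra.
  by rewrite ler_sqr ?nnegrE// (le_trans xd0 le).
have h8 : E * (kappa * delta ^+ 2) <= E * (16 * K2 * E * L ^+ 2).
  have := ler_wpM2l K20 h7; have := ler_wpM2r (sqr_ge0 delta) h6; rewrite !exprMn; nra.
have {}h8 : kappa * delta ^+ 2 <= 16 * K2 * E * L ^+ 2 by rewrite ler_pM2l in h8.
apply: (le_trans h8).
have -> : 32 * K2 * M * (t / s) * (N.+1%:R ^+ (j.+1 * 2) * (s / t) ^+ N.+1) =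
          16 * K2 * (2 * M * (s / t) ^+ N) * L ^+ 2.
  rewrite exprM -/L [_ ^+ N.+1]exprSr.
  have ts : t / s * (s / t) = 1 by rewrite mulrA divfK ?divff// gt_eqF.
  transitivity (32 * K2 * M * (t / s * (s / t)) * (L ^+ 2 * (s / t) ^+ N)).
    by ring.
  by rewrite ts; ring.
rewrite ler_wpM2r ?sqr_ge0// ler_wpM2l// mulr_ge0//.
Qed.

End SwapRigidity.

(** * Borel sets of the complex plane *)

Section BorelComplex.
Context {R : realType}.
Implicit Types (A B : set R[i]) (z y : R[i]).

Lemma open_nc A : (forall z, A z -> exists2 e : R, 0 < e &
    forall y, nc (z - y) < e -> A y) -> open A.
Proof.
move=> h; rewrite openE => z /h[e e0 he]; apply/nbhs_ballP.
exists e%:C => /=; first by rewrite ltcR.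
by move=> y; rewrite /ball/= normrc ltcR; exact: he.
Qed.

Lemma borelC_open A : open A -> borelC A.
Proof. by move=> oA; exact: sub_sigma_algebra. Qed.

Lemma borelCT : borelC (@setT R[i]).
Proof. by apply: borelC_open; exact: openT. Qed.

Lemma borelCC A : borelC A -> borelC (~` A).
Proof. exact: (@measurableC _ (g_sigma_algebraType (@open R[i]))). Qed.

Lemma borelCI A B : borelC A -> borelC B -> borelC (A `&` B).
Proof.
by move=> bA bB; apply: (@measurableI _ (g_sigma_algebraType (@open R[i]))).
Qed.

Lemma open_Re_lt (q : R) : open [set z : R[i] | complex.Re z < q].
Proof.
apply: open_nc => z /= zq; exists (q - complex.Re z); first by rewrite subr_gt0.
move=> y; rewrite nc_distC => /(le_lt_trans (nc_ge_Re _)) /(le_lt_trans (ler_norm _)).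
by case: z y {zq} => [? ?] [? ?] /=; rewrite ltrD2r.
Qed.

Lemma open_Re_gt (q : R) : open [set z : R[i] | q < complex.Re z].
Proof.
apply: open_nc => z /= zq; exists (complex.Re z - q); first by rewrite subr_gt0.
move=> y; move=> /(le_lt_trans (nc_ge_Re _)) /(le_lt_trans (ler_norm _)).
by case: z y {zq} => [? ?] [? ?] /=; rewrite ltrD2l ltrN2.
Qed.

Lemma open_Im_lt (q : R) : open [set z : R[i] | complex.Im z < q].
Proof.
apply: open_nc => z /= zq; exists (q - complex.Im z); first by rewrite subr_gt0.
move=> y; rewrite nc_distC => /(le_lt_trans (nc_ge_Im _)) /(le_lt_trans (ler_norm _)).
by case: z y {zq} => [? ?] [? ?] /=; rewrite ltrD2r.
Qed.

Lemma open_Im_gt (q : R) : open [set z : R[i] | q < complex.Im z].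
Proof.
apply: open_nc => z /= zq; exists (complex.Im z - q); first by rewrite subr_gt0.
move=> y; move=> /(le_lt_trans (nc_ge_Im _)) /(le_lt_trans (ler_norm _)).
by case: z y {zq} => [? ?] [? ?] /=; rewrite ltrD2l ltrN2.
Qed.

Lemma open_nc_gt (q : R) : open [set z : R[i] | q < nc z].
Proof.
apply: open_nc => z /= zq; exists (nc z - q); first by rewrite subr_gt0.
move=> y /(le_lt_trans (nc_subl _ _)); rewrite ltrD2l ltrN2//.
Qed.

Lemma borelC_set1_0 : borelC [set (0 : R[i])].
Proof.
have -> : [set (0 : R[i])] = ~` [set z | 0 < nc z].
  apply/seteqP; split=> z /=; first by move=> ->; rewrite nc0 ltxx.
  by rewrite nc_gt0 => /negP; rewrite negbK => /eqP.
by apply: borelCC; apply: borelC_open; exact: open_nc_gt.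
Qed.

End BorelComplex.

(** * The measurable space of coefficient sequences *)

Section PathSpace.
Context {R : realType}.
Implicit Types (B : nat -> set R[i]) (x : nat -> R[i]).

Definition rect n B : set (nat -> R[i]) := [set x | forall k, (k < n)%N -> B k (x k)].

Definition rects : set (set (nat -> R[i])) :=
  [set A | exists n B, (forall k, borelC (B k)) /\ A = rect n B].

(** The space of coefficient sequences with its product sigma-algebra. *)
Definition path_space := g_sigma_algebraType rects.

Lemma rect_extend n m B : (n <= m)%N ->
  rect n B = rect m (fun k => if (k < n)%N then B k else setT).
Proof.
move=> nm; apply/seteqP; split=> x /= h k kn.
  by case: ifPn => // /h.
by have := h k (leq_trans kn nm); rewrite kn.
Qed.

Lemma rects_setI : setI_closed rects.
Proof.
move=> _ _ [n [B [mB ->]]] [m [C [mC ->]]].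
exists (maxn n m), (fun k => (if (k < n)%N then B k else setT) `&`
                    (if (k < m)%N then C k else setT)); split.
  by move=> k; apply: borelCI; case: ifP => // _; exact: borelCT.
rewrite (rect_extend B (leq_maxl n m)) (rect_extend C (leq_maxr n m)).
apply/seteqP; split=> x /= h.
  by move=> k kn; split; [exact: h.1|exact: h.2].
by split=> k kn; have [] := h k kn.
Qed.

Lemma coordinate_measurable k (B : set R[i]) : borelC B ->
  measurable [set x : path_space | B (x k)].
Proof.
move=> mB; apply: sub_sigma_algebra.
exists k.+1, (fun i => if i == k then B else setT); split.
  by move=> i; case: ifP => // _; exact: borelCT.
apply/seteqP; split=> x /= h; last by have := h k (ltnSn k); rewrite eqxx.
by move=> i _; case: ifP => // /eqP ->.
Qed.

Lemma measurable_fun_gt d (T : measurableType d) (f : T -> R) :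
  (forall y, measurable [set x | y < f x]) -> measurable_fun setT f.
Proof.
move=> h; apply: (measurability _ (RGenOInfty.measurableE R)) => //.
move=> _ [_ [y ->] <-]; rewrite setTI.
rewrite [X in measurable X](_ : _ = [set x | y < f x])//.
by apply/seteqP; split=> x /=; rewrite in_itv/= andbT.
Qed.

Lemma measurable_Re k : measurable_fun setT (fun x : path_space => complex.Re (x k)).
Proof.
apply: measurable_fun_gt => y.
apply: (@coordinate_measurable k [set z | y < complex.Re z]).
by apply: borelC_open; exact: open_Re_gt.
Qed.

Lemma measurable_Im k : measurable_fun setT (fun x : path_space => complex.Im (x k)).
Proof.
apply: measurable_fun_gt => y.
apply: (@coordinate_measurable k [set z | y < complex.Im z]).
by apply: borelC_open; exact: open_Im_gt.
Qed.

Lemma coef_bound_measurable (t M : R) : 0 < t ->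
  measurable [set x : path_space | coef_bound t M x].
Proof.
move=> t0; have -> : [set x : path_space | coef_bound t M x] =
    \bigcap_k [set x | (~` [set z | M / t ^+ k < nc z]) (x k)].
  apply/seteqP; split=> x /= h k.
    by move=> _ /=; apply/negP; rewrite -leNgt ler_pdivlMr ?exprn_gt0.
  by have /negP := h k I; rewrite -leNgt ler_pdivlMr ?exprn_gt0.
apply: bigcapT_measurable => k.
apply: (@coordinate_measurable k (~` [set z | M / t ^+ k < nc z])).
by apply: borelCC; apply: borelC_open; exact: open_nc_gt.
Qed.

Lemma mulc_ReIm (w z : R[i]) :
  (complex.Re (w * z) = complex.Re w * complex.Re z - complex.Im w * complex.Im z) *
  (complex.Im (w * z) = complex.Re w * complex.Im z + complex.Im w * complex.Re z).
Proof. by case: w z => [? ?] [? ?]. Qed.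

Lemma nc_ReIm (z : R[i]) :
  nc z = Num.sqrt (complex.Re z * complex.Re z + complex.Im z * complex.Im z).
Proof. by case: z. Qed.

Lemma euler_measurable j (s t M : R) z : 0 < s < t -> nc z <= s ->
  let X := [set x : path_space | coef_bound t M x] in
  measurable_fun X (fun x => complex.Re (euler j x z)) /\
  measurable_fun X (fun x => complex.Im (euler j x z)).
Proof.
move=> st zs X.
have t0 : 0 < t by case/andP: st => s0 /(lt_trans s0).
pose w k : R[i] := k%:R ^+ j * z ^+ k.
have wE (x : path_space) : (fun k => k%:R ^+ j * x k * z ^+ k) = (fun k => w k * x k).
  by apply/funext => k; rewrite /w mulrAC.
have mX : measurable X by exact: coef_bound_measurable.
have cvgx (x : path_space) : X x ->
    series (fun k => w k * x k) @ \oo --> euler j x z.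
  by move=> Xx; rewrite /euler wE; apply: csum_cvg; rewrite -wE; exact: (euler_asum st Xx zs).
pose h := fun n (x : path_space) => series (fun k => w k * x k) n.
split.
- apply: (@measurable_fun_cvg _ path_space R X (fun n x => complex.Re (h n x))
      (fun x => complex.Re (euler j x z))).
    move=> n; apply: measurable_funTS; elim: n => [|n ih].
      have -> : (fun x : path_space => complex.Re (h 0%N x)) = cst 0.
        by apply/funext => x; rewrite /h /series/= big_geq.
      exact: measurable_cst.
    have -> : (fun x : path_space => complex.Re (h n.+1 x)) =
        (fun x => complex.Re (h n x) + (complex.Re (w n) * complex.Re (x n) -
                                        complex.Im (w n) * complex.Im (x n))).
      by apply/funext => x; rewrite /h seriesSr ReD mulc_ReIm.
    apply: measurable_funD => //; apply: measurable_funB.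
      by apply: measurable_funM; [exact: measurable_cst|exact: measurable_Re].
    by apply: measurable_funM; [exact: measurable_cst|exact: measurable_Im].
  move=> x /cvgx/cvg_ncP hx; apply/cvgrPdist_lt => e /hx[N HN].
  exists N => // n /HN; apply: le_lt_trans.
  by apply: le_trans (nc_ge_Re _); rewrite /h; case: (euler _ _ _) (series _ _) => [? ?] [? ?].
- apply: (@measurable_fun_cvg _ path_space R X (fun n x => complex.Im (h n x))
      (fun x => complex.Im (euler j x z))).
    move=> n; apply: measurable_funTS; elim: n => [|n ih].
      have -> : (fun x : path_space => complex.Im (h 0%N x)) = cst 0.
        by apply/funext => x; rewrite /h /series/= big_geq.
      exact: measurable_cst.
    have -> : (fun x : path_space => complex.Im (h n.+1 x)) =
        (fun x => complex.Im (h n x) + (complex.Re (w n) * complex.Im (x n) +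
                                        complex.Im (w n) * complex.Re (x n))).
      by apply/funext => x; rewrite /h seriesSr ImD mulc_ReIm.
    apply: measurable_funD => //; apply: measurable_funD.
      by apply: measurable_funM; [exact: measurable_cst|exact: measurable_Im].
    by apply: measurable_funM; [exact: measurable_cst|exact: measurable_Re].
  move=> x /cvgx/cvg_ncP hx; apply/cvgrPdist_lt => e /hx[N HN].
  exists N => // n /HN; apply: le_lt_trans.
  by apply: le_trans (nc_ge_Im _); rewrite /h; case: (euler _ _ _) (series _ _) => [? ?] [? ?].
Qed.

Lemma nc_euler_measurable j (s t M : R) z : 0 < s < t -> nc z <= s ->
  measurable_fun [set x : path_space | coef_bound t M x] (fun x => nc (euler j x z)).
Proof.
move=> st zs; have [mR mI] := euler_measurable j M st zs.
have -> : (fun x : path_space => nc (euler j x z)) = Num.sqrt \o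
    (fun x : path_space => complex.Re (euler j x z) * complex.Re (euler j x z)
                         + complex.Im (euler j x z) * complex.Im (euler j x z)).
  by apply/funext => x; rewrite /= nc_ReIm.
apply: (measurableT_comp (continuous_measurable_fun (@sqrt_continuous R))).
by apply: measurable_funD; apply: measurable_funM.
Qed.

End PathSpace.

(** * Measurability of the existence of a zero *)

Section ZerosOnSquare.
Context {R : realType}.

Definition square : set (R * R) := `[-1, 1]%classic `*` `[-1, 1]%classic.

Lemma rat_near_unit (u e : R) : -1 <= u <= 1 -> 0 < e ->
  exists q : rat, (-1 : R) <= ratr q <= (1 : R) /\ `|u - ratr q| < e.
Proof.
move=> /andP[u1 u2] e0.
have : Num.max (-1) (u - e) < Num.min 1 (u + e).
  by rewrite gt_max !lt_min; apply/andP; split; apply/andP; split; lra.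
move=> /rat_in_itvoo[q]; rewrite in_itv/= gt_max lt_min => /andP[/andP[q1 q2] /andP[q3 q4]].
exists q; split; first by rewrite !ltW.
by rewrite ltr_norml; lra.
Qed.

Definition square_lipschitz (h : R * R -> R) := exists2 L, 0 <= L &
  forall p p', square p -> square p' -> `|h p - h p'| <= L * (`|p.1 - p'.1| + `|p.2 - p'.2|).

Lemma square_lipschitz_continuous h : square_lipschitz h ->
  {within square, continuous h}.
Proof.
move=> [L L0 HL]; apply/subspace_continuousP => p Kp.
apply/cvgrPdist_lt => e e0.
pose r := e / (L * 2 + 1).
have r0 : 0 < r by rewrite divr_gt0// ltr_wpDl// mulr_ge0.
rewrite near_withinE; apply/nbhs_ballP; exists r => //= p' [/ltW b1 /ltW b2] Kp'.
apply: (le_lt_trans (HL _ _ Kp Kp')).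
apply: (@le_lt_trans _ _ (L * (r + r))).
  by rewrite ler_wpM2l// lerD.
have -> : e = r * (L * 2 + 1).
  by rewrite /r divfK// gt_eqF// ltr_wpDl// mulr_ge0.
lra.
Qed.

(** By compactness a continuous nonnegative function vanishes somewhere on the
    square iff it takes arbitrarily small values at its rational points. *)
Lemma zero_on_square_measurable d (T : measurableType d) (D : set T)
    (h : T -> R * R -> R) : measurable D ->
  (forall p, square p -> measurable_fun D (h ^~ p)) ->
  (forall x, D x -> square_lipschitz (h x)) ->
  (forall x p, 0 <= h x p) ->
  measurable [set x | D x /\ exists p, square p /\ h x p = 0].
Proof.
move=> mD mh lh h0.
pose rp (q : rat * rat) : R * R := (ratr q.1, ratr q.2).
have -> : [set x | D x /\ exists p, square p /\ h x p = 0] =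
  \bigcap_n \bigcup_q (if `[< square (rp q) >] then D `&` [set x | h x (rp q) < n.+1%:R^-1]
                       else set0).
  apply/seteqP; split=> [x [Dx [p [Kp hp]]] n _|x /= H].
    have [L L0 HL] := lh x Dx.
    pose e : R := n.+1%:R^-1 / (L * 2 + 1).
    have L1 : 0 < L * 2 + 1 by rewrite ltr_wpDl// mulr_ge0.
    have n0 : 0 < n.+1%:R^-1 :> R by rewrite invr_gt0.
    have e0 : 0 < e by rewrite divr_gt0.
    have [K1 K2] := Kp; rewrite /= !in_itv/= in K1 K2.
    have [q1 [q1K q1e]] := rat_near_unit K1 e0.
    have [q2 [q2K q2e]] := rat_near_unit K2 e0.
    have Kq : square (rp (q1, q2)) by split; rewrite /= in_itv.
    exists (q1, q2) => //; rewrite asboolT//; split => //=.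
    have := HL _ _ Kp Kq; rewrite hp sub0r normrN => /(le_trans (ler_norm _)).
    move/le_lt_trans; apply; apply: (@le_lt_trans _ _ (L * (e + e))).
      by rewrite ler_wpM2l// lerD// ltW.
    have -> : n.+1%:R^-1 = e * (L * 2 + 1) by rewrite /e divfK// gt_eqF.
    lra.
  have Dx : D x by have [q _] := H 0 I; case: ifP => // _ [].
  split=> //.
  have K0 : square !=set0.
    by exists (0, 0); split; rewrite /= in_itv/= lerN10 ler01.
  have cK : compact square by apply: compact_setX; exact: segment_compact.
  have [p Kp pmin] := compact_EVT_min K0 cK (square_lipschitz_continuous (lh x Dx)).
  exists p; split; first exact: set_mem Kp.
  apply/eqP; rewrite eq_le h0 andbT leNgt; apply/negP => hp.
  have [n hn] : exists n, n.+1%:R^-1 < h x p.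
    exists (Num.bound (h x p)^-1); rewrite invf_plt ?posrE//.
    apply: (lt_le_trans (archi_boundP _)); first by rewrite invr_ge0 ltW.
    by rewrite ler_nat.
  have [q _] := H n I; case: asboolP => // Kq [_ /=].
  have := pmin (rp q) (mem_set Kq) => /le_lt_trans /[apply].
  by move=> /(lt_trans hn); rewrite ltxx.
apply: bigcapT_measurable => n; apply: countable_bigcupT_measurable => // q.
case: asboolP => // Kq.
have := mh _ Kq mD `]-oo, n.+1%:R^-1[%classic (measurable_itv _).
by rewrite preimage_itvNyo.
Qed.

End ZerosOnSquare.

(** * The events of having a double zero *)

Section DegenerateZeros.
Context {R : realType}.
Implicit Types (x : nat -> R[i]) (z y : R[i]) (q : R * R) (r : R).

Definition square_point q r (p : R * R) : R[i] := (q.1 + r * p.1) +i* (q.2 + r * p.2).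

Definition box q r : set R[i] := square_point q r @` square.

Lemma nc_square_point q r p p' : 0 <= r ->
  nc (square_point q r p - square_point q r p') <= r * (`|p.1 - p'.1| + `|p.2 - p'.2|).
Proof.
move=> r0; apply: (le_trans (nc_le_ReIm _)); rewrite /= mulrDr.
have E (a b c : R) : `|a + r * b + - (a + r * c)| = r * `|b - c|.
  have -> : a + r * b + - (a + r * c) = r * (b - c) by ring.
  by rewrite normrM ger0_norm.
by rewrite !E.
Qed.

Lemma box_diameter q r z y : 0 <= r -> box q r z -> box q r y -> nc (z - y) <= 4 * r.
Proof.
move=> r0 [p [p1 p2] <-] [p' [p1' p2'] <-].
rewrite /= !in_itv/= in p1 p2 p1' p2'.
apply: (le_trans (nc_square_point _ _ _ r0)); rewrite mulrC ler_wpM2r//.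
have [h1 h2] : `|p.1 - p'.1| <= 2 /\ `|p.2 - p'.2| <= 2.
  by rewrite !ler_norml; lra.
lra.
Qed.

(** The bound M, the lower bound delta and the size of the box make the
    degeneracy uniform, as [swap_rigidity] requires; with delta = 0 this is the
    mere vanishing of two consecutive iterates. *)
Definition box_zero j (t M delta : R) q r : set (nat -> R[i]) :=
  [set x | coef_bound t M x /\ exists z, [/\ box q r z, euler j x z = 0,
     euler j.+1 x z = 0 & delta <= nc (euler j.+2 x z)]].

Lemma dist_sum_max (a a' b b' c c' A B C D d : R) :
  `|a - a'| <= A * D -> `|b - b'| <= B * D -> `|c - c'| <= C * D ->
  `|a + b + Num.max 0 (d - c) - (a' + b' + Num.max 0 (d - c'))| <= (A + B + C) * D.
Proof.
rewrite !mulrDl !ler_norml.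
by case: (leP 0 (d - c)) => ?; case: (leP 0 (d - c')) => ?; lra.
Qed.

Lemma box_zero_measurable j (s t M delta : R) q r : 0 < s < t -> 0 <= r ->
  (forall z, box q r z -> nc z <= s) ->
  measurable (box_zero j t M delta q r : set (@path_space R)).
Proof.
move=> st r0 bs; have t0 : 0 < t by case/andP: st => s0 /(lt_trans s0).
have s0 : 0 < s by case/andP: st.
(* The three terms vanish exactly when the three conditions at the point hold. *)
pose h (x : @path_space R) p := nc (euler j x (square_point q r p)) +
  nc (euler j.+1 x (square_point q r p)) +
  Num.max 0 (delta - nc (euler j.+2 x (square_point q r p))).
have sqs p : square p -> nc (square_point q r p) <= s by move=> ?; apply: bs; exists p.
have max0 (u : R) : 0 <= Num.max 0 u by rewrite le_max lexx.
have -> : box_zero j t M delta q r = [set x | coef_bound t M x /\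
    exists p, square p /\ h x p = 0] :> set (@path_space R).
  apply/seteqP; split=> x [cx].
    move=> [z [[p Kp <-] e0 e1 e2]]; split=> //; exists p; split=> //.
    rewrite /h e0 e1 nc0 !add0r; apply/eqP; rewrite eq_le max0 andbT.
    by rewrite ge_max lexx subr_le0.
  move=> [p [Kp /eqP]]; rewrite /h paddr_eq0 ?addr_ge0 ?nc_ge0//.
  rewrite paddr_eq0 ?nc_ge0// !nc_eq0 => /andP[/andP[/eqP e0 /eqP e1] /eqP e2].
  split=> //; exists (square_point q r p); split=> //; first by exists p.
  by rewrite -subr_le0 -e2 le_max lexx orbT.
apply: (@zero_on_square_measurable R _ _ [set x : @path_space R | coef_bound t M x]).
- exact: coef_bound_measurable.
- move=> p Kp; have mE i := @nc_euler_measurable R i s t M _ st (sqs p Kp).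
  apply: measurable_funD; first by apply: measurable_funD.
  by apply: measurable_maxr; [exact: measurable_cst|
     apply: measurable_funB; [exact: measurable_cst|]].
- move=> x cx.
  pose C i := majorant i.+1 s t M * (r / s).
  have C0 i : 0 <= C i.
    by rewrite mulr_ge0// ?divr_ge0 ?(ltW s0)//; exact: majorant_ge0 st cx _.
  have lipE i p p' : square p -> square p' ->
      `|nc (euler i x (square_point q r p)) - nc (euler i x (square_point q r p'))|
       <= C i * (`|p.1 - p'.1| + `|p.2 - p'.2|).
    move=> Kp Kp'.
    have lip1 p1 p2 : square p1 -> square p2 ->
      nc (euler i x (square_point q r p1)) - nc (euler i x (square_point q r p2))
       <= C i * (`|p1.1 - p2.1| + `|p1.2 - p2.2|).
      move=> K1 K2; apply: (le_trans (nc_subl _ _)).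
      apply: (le_trans (euler_lipschitz st cx i (sqs _ K1) (sqs _ K2))).
      rewrite /C -mulrA ler_wpM2l ?(majorant_ge0 st cx)// mulrAC ler_wpM2r ?invr_ge0 ?(ltW s0)//.
      exact: nc_square_point.
    rewrite ler_norml lip1// andbT lerNl opprB (distrC p.1) (distrC p.2).
    exact: lip1.
  exists (C j + C j.+1 + C j.+2); first by rewrite !addr_ge0.
  by move=> p p' Kp Kp'; apply: dist_sum_max; exact: lipE.
- by move=> x p; rewrite /h !addr_ge0 ?nc_ge0.
Qed.

(** Points are bounded by the inner radius and coefficients by powers of the
    outer one; both increase to 1. *)
Definition inner_radius n : R := n.+1%:R / n.+3%:R.
Definition outer_radius n : R := n.+2%:R / n.+3%:R.

Lemma radii n : 0 < inner_radius n < outer_radius n.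
Proof.
rewrite /inner_radius /outer_radius divr_gt0//=.
by rewrite ltr_pM2r ?invr_gt0// ltr_nat.
Qed.

Lemma outer_radius_lt1 n : 0 < outer_radius n < 1.
Proof.
rewrite /outer_radius divr_gt0//= ltr_pdivrMr// mul1r ltr_nat//.
Qed.

Lemma inner_radius_gt (u : R) : u < 1 -> exists n, u < inner_radius n.
Proof.
move=> u1; exists (Num.bound (2 / (1 - u))).
set n := Num.bound _.
have h : 2 / (1 - u) < n%:R.
  by apply: le_lt_trans (archi_boundP _); rewrite ?divr_ge0// subr_ge0 ltW.
move: h; rewrite ltr_pdivrMr ?subr_gt0// /inner_radius ltr_pdivlMr// => h.
have := ler0n R n; rewrite -addn3 -addn1 !natrD.
nra.
Qed.

Lemma outer_radius_gt (u : R) : u < 1 -> exists n, u < outer_radius n.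
Proof.
move=> /inner_radius_gt[n un]; exists n; apply: lt_trans un _.
by have /andP[] := radii n.
Qed.

Lemma tameP x : tame x <-> forall n, exists M : nat, coef_bound (outer_radius n) M%:R x.
Proof.
split=> [tx n|h t /andP[t0 t1]].
  have [M hM] := tx _ (outer_radius_lt1 n).
  exact: coef_bound_nat (coef_bound_ge0 hM) hM.
have [n tn] := outer_radius_gt t1; have [M hM] := h n.
by exists M%:R; apply: coef_bound_le hM; rewrite !ltW.
Qed.

Lemma tame_measurable : measurable [set x : @path_space R | tame x].
Proof.
have -> : [set x : @path_space R | tame x] =
    \bigcap_n \bigcup_M [set x | coef_bound (outer_radius n) M%:R x].
  apply/seteqP; split=> x /=.
    by move/tameP => h n _; have [M hM] := h n; exists M.
  by move=> h; apply/tameP => n; have [M _ hM] := h n I; exists M.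
apply: bigcapT_measurable => n; apply: bigcupT_measurable => M.
by apply: coef_bound_measurable; have /andP[] := outer_radius_lt1 n.
Qed.

Definition rat_point (q : rat * rat) : R * R := (ratr q.1, ratr q.2).
Definition mesh (m : nat) : R := m.+1%:R^-1.

Lemma mesh_gt0 m : 0 < mesh m. Proof. by rewrite invr_gt0. Qed.

Definition admissible n (q : rat * rat) m :=
  (forall z, box (rat_point q) (mesh m) z -> nc z <= inner_radius n) /\
  ~ box (rat_point q) (mesh m) 0.

Lemma box_around n z (e : R) : z != 0 -> nc z < inner_radius n -> 0 < e ->
  exists (q : rat * rat) m, [/\ box (rat_point q) (mesh m) z, 4 * mesh m <= e & admissible n q m].
Proof.
move=> z0 zn e0.
pose e' := Num.min e (Num.min (inner_radius n - nc z) (nc z / 2)).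
have e'0 : 0 < e' by rewrite !lt_min e0 subr_gt0 zn divr_gt0// nc_gt0.
pose m := Num.bound (4 / e').
have hm : 4 * mesh m <= e'.
  rewrite /mesh ler_pdivrMr// mulrC -ler_pdivrMr//.
  have h : 4 / e' < m%:R by apply: archi_boundP; rewrite divr_ge0// ltW.
  by rewrite (le_trans (ltW h))// ler_nat.
have m0 := mesh_gt0 m.
have near (w u : R) : 0 < w -> exists q : rat, -1 <= (u - ratr q) / w <= 1.
  move=> w0; have /rat_in_itvoo[q] : u - w < u by rewrite gtrDl oppr_lt0.
  rewrite in_itv/= => /andP[q1 q2]; exists q.
  by rewrite ler_pdivlMr// ler_pdivrMr// mul1r mulN1r; apply/andP; split; lra.
have [q1 h1] := near _ (complex.Re z) m0; have [q2 h2] := near _ (complex.Im z) m0.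
have bz : box (rat_point (q1, q2)) (mesh m) z.
  exists ((complex.Re z - ratr q1) / mesh m, (complex.Im z - ratr q2) / mesh m).
    by split; rewrite /= in_itv.
  rewrite /square_point/= ![mesh m * _]mulrC !divfK ?gt_eqF// ![_ + (_ - _)]addrC !subrK.
  by case: z {z0 zn e' e'0 m hm m0 near h1 h2}.
have [he [hi hz]] : [/\ 4 * mesh m <= e, 4 * mesh m <= inner_radius n - nc z &
    4 * mesh m <= nc z / 2] by move: hm; rewrite !le_min => /and3P[].
have diam y : box (rat_point (q1, q2)) (mesh m) y -> nc (y - z) <= 4 * mesh m.
  by move=> by_; exact: box_diameter (ltW m0) by_ bz.
exists (q1, q2), m; split=> //; split=> [y /diam|/diam].
  by move=> h; have := nc_subl y z; lra.
by rewrite sub0r ncN => h; have nz : 0 < nc z; [rewrite nc_gt0|lra].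
Qed.

(** At z <> 0 the first two Euler iterates vanish together exactly when the
    power series and its derivative do, see [path_derive1] below. *)
Definition double_zero_off_0 : set (nat -> R[i]) :=
  [set x | tame x /\ exists z, [/\ z != 0, nc z < 1, euler 0 x z = 0 & euler 1 x z = 0]].

Lemma double_zero_off_0_measurable : measurable (double_zero_off_0 : set (@path_space R)).
Proof.
have -> : double_zero_off_0 = [set x : @path_space R | tame x] `&`
  \bigcup_(i in setT : set (nat * nat * nat * (rat * rat)))
    (if `[< admissible i.1.1.1 i.2 i.1.2 >] then
       box_zero 0 (outer_radius i.1.1.1) i.1.1.2%:R 0 (rat_point i.2) (mesh i.1.2)
     else set0).
  apply/seteqP; split=> x.
    move=> [tx [z [z0 z1 e0 e1]]]; split=> //.
    have [n zn] := inner_radius_gt z1.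
    have [M xM] := (tameP x).1 tx n.
    have [q [m [bz _ adm]]] := box_around z0 zn ltr01.
    exists (n, M, m, q) => //=; rewrite asboolT//; split=> //; exists z; split=> //.
    exact: nc_ge0.
  move=> [tx [[[[n M] m] q] _ /=]]; case: asboolP => // -[adm1 adm2] [xM [z [bz e0 e1 _]]].
  split=> //; exists z; split=> //.
    by apply/eqP => z0; apply: adm2; rewrite -z0.
  apply: (le_lt_trans (adm1 _ bz)); have /andP[_ io] := radii n.
  by apply: (lt_trans io); have /andP[] := outer_radius_lt1 n.
apply: measurableI; first exact: tame_measurable.
apply: countable_bigcupT_measurable => // -[[[n M] m] q] /=.
case: asboolP => // -[adm1 _].
exact: box_zero_measurable (radii n) (ltW (mesh_gt0 m)) adm1.
Qed.

Definition swap_rigid (A : set (nat -> R[i])) :=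
  exists N0, forall N x, (N0 <= N)%N -> A x -> A (x \o swap N) -> x N = x N.+1.

Lemma box_zero_rigid j n (M delta : R) : 0 < delta ->
  exists2 e : R, 0 < e & forall (q : rat * rat) m, 4 * mesh m <= e -> admissible n q m ->
    swap_rigid (box_zero j (outer_radius n) M delta (rat_point q) (mesh m)).
Proof.
move=> d0; have /andP[_ o1] := outer_radius_lt1 n.
have [e e0 [N0 H]] := swap_rigidity j M (radii n) o1 d0.
exists e => // q m me [adm1 adm2]; exists N0 => N x N0N [cx [z [bz e0z e1z _]]].
move=> [cx' [y [by_ e0y e1y e2y]]].
have n0 w : box (rat_point q) (mesh m) w -> w != 0.
  by move=> bw; apply/eqP => w0; apply: adm2; rewrite -w0.
apply: (H N x z y) => //; [exact: adm1|exact: n0|exact: adm1|exact: n0|].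
by apply: le_trans me; exact: box_diameter (ltW (mesh_gt0 m)) bz by_.
Qed.

(** The order j, the bounds on the coefficients and on [euler j.+2], and finally
    a box around the zero, small enough for [box_zero_rigid], all range over
    countable sets. *)
Lemma double_zero_off_0_cover : exists (I : countType) (A : I -> set (nat -> R[i])),
  [/\ forall i, measurable (A i : set (@path_space R)), forall i, swap_rigid (A i) &
      forall x, double_zero_off_0 x -> (exists k, x k != 0) -> exists i, A i x].
Proof.
pose I : countType := (nat * nat * nat * (rat * rat) * nat * nat)%type.
pose Z j n M d (q : rat * rat) m :=
  box_zero j (outer_radius n) M%:R (mesh d) (rat_point q) (mesh m).
pose A (i : I) := let: (n, M, m, q, j, d) := i in
  if `[< admissible n q m /\ swap_rigid (Z j n M d q m) >] then Z j n M d q m else set0.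
exists I, A; split=> [[[[[[n M] m] q] j] d]|[[[[[n M] m] q] j] d]|x [tx [z [z0 z1 e0 e1]]] [k xk]] /=.
- case: asboolP => // -[[adm1 _] _].
  exact: box_zero_measurable (radii n) (ltW (mesh_gt0 m)) adm1.
- by case: asboolP => [[]//|_]; exists 0%N.
have [all0|[j [ej ej1 ej2]]] := finite_order tx z1 z0 e0 e1.
  by rewrite all0 eqxx in xk.
have [n zn] := inner_radius_gt z1.
have [M xM] := (tameP x).1 tx n.
pose d := Num.bound (nc (euler j.+2 x z))^-1.
have ed : mesh d <= nc (euler j.+2 x z).
  have e20 : 0 < nc (euler j.+2 x z) by rewrite nc_gt0.
  rewrite /mesh invf_ple ?posrE//; apply: (le_trans (ltW (archi_boundP _))).
    by rewrite invr_ge0 ltW.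
  by rewrite ler_nat.
have [e e'0 rig] := box_zero_rigid j n M%:R (mesh_gt0 d).
have [q [m [bz me adm]]] := box_around z0 zn e'0.
exists (n, M, m, q, j, d); rewrite /= asboolT; first by split=> //; exists z.
by split=> //; exact: rig.
Qed.

End DegenerateZeros.

(** * Real-valued probabilities *)

Section RealProbability.
Context {R : realType} {d : measure_display} {T : measurableType d}.
Variable P : probability T R.
Implicit Types (X Y : set T).

Definition pr X : R := fine (P X).

Lemma prE X : measurable X -> P X = (pr X)%:E.
Proof. by move=> mX; rewrite /pr fineK// fin_num_measure. Qed.

Lemma pr_ge0 X : 0 <= pr X. Proof. exact: fine_ge0. Qed.

Lemma pr_le X Y : measurable X -> measurable Y -> X `<=` Y -> pr X <= pr Y.
Proof.
move=> mX mY XY; rewrite -lee_fin -!prE//.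
by apply: le_measure => //; exact: mem_set.
Qed.

Lemma pr_split X Y : measurable X -> measurable Y ->
  pr X = pr (X `&` Y) + pr (X `\` Y).
Proof.
move=> mX mY; apply: EFin_inj; rewrite EFinD -!prE//.
- by rewrite addeC; exact: measureDI.
- exact: measurableD.
- exact: measurableI.
Qed.

Lemma prU X Y : measurable X -> measurable Y -> X `&` Y = set0 ->
  pr (X `|` Y) = pr X + pr Y.
Proof.
move=> mX mY XY; apply: EFin_inj; rewrite EFinD -!prE//.
- exact: measureU.
- exact: measurableU.
Qed.

Lemma prU_le X Y : measurable X -> measurable Y -> pr (X `|` Y) <= pr X + pr Y.
Proof.
move=> mX mY; rewrite -lee_fin EFinD -!prE//; first exact: measureU2.
exact: measurableU.
Qed.

Lemma pr_setT : pr setT = 1. Proof. by rewrite /pr probability_setT. Qed.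

Lemma pr_set0 : pr set0 = 0. Proof. by rewrite /pr measure0. Qed.

Lemma pr_setC X : measurable X -> pr (~` X) = 1 - pr X.
Proof.
by move=> mX; rewrite -pr_setT (pr_split measurableT mX) setTI setTD addrAC subrr add0r.
Qed.

Lemma bigsetU_ordP U (F : nat -> set U) K u :
  (\big[setU/set0]_(k < K) F k) u <-> exists2 k, (k < K)%N & F k u.
Proof.
by rewrite -(bigcup_mkord K F); split=> [] [k kK Fk]; exists k.
Qed.

Lemma pr_tail (F : nat -> set T) (e : R) : (forall k, measurable (F k)) -> 0 < e ->
  exists K, pr ((\bigcup_k F k) `\` \big[setU/set0]_(k < K) F k) <= e.
Proof.
move=> mF e0.
pose G K := (\bigcup_k F k) `\` \big[setU/set0]_(k < K) F k.
have mU : measurable (\bigcup_k F k) by exact: bigcupT_measurable.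
have mG K : measurable (G K).
  by apply: measurableD => //; apply: bigsetU_measurable.
have G0 : \bigcap_K G K = set0.
  rewrite -subset0 => w h; have [[k _ Fk] _] := h 0 I.
  by have [_] := h k.+1 I; apply; apply/bigsetU_ordP; exists k.
have cG : P \o G @ \oo --> 0%E.
  rewrite -(measure0 P) -G0; apply: nonincreasing_cvg_mu => //.
  - by apply: le_lt_trans (probability_le1 _ (mG 0)) _; rewrite ltry.
  - by rewrite G0; exact: measurable0.
  - move=> m n mn; apply/subsetPset; apply: setDS.
    by apply: subset_bigsetU.
move/fine_cvgP: cG => [_ /cvgrPdist_lt/(_ e e0)[K _ /(_ K (leqnn K)) hK]].
exists K; apply/ltW; apply: le_lt_trans hK.
by rewrite /= sub0r normrN ler_norm.
Qed.

End RealProbability.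

(** * Exchange invariance and mixing of an i.i.d. sequence *)

Section IIDPaths.
Context {R : realType} {d : measure_display} {T : measurableType d}.
Variables (P : probability T R) (a : nat -> T -> R[i]).
Hypothesis iid : iid_seq P a.

Local Notation pr := (pr P).
Implicit Types (A : set (nat -> R[i])).

Definition path (w : T) : nat -> R[i] := a^~ w.

Let mu (B : set R[i]) := P (a 0 @^-1` B).

Lemma rv_measurable k (B : set R[i]) : borelC B -> measurable (a k @^-1` B).
Proof. by case: iid => h _ _; exact: h. Qed.

(** Stated up to an involution tau of the indices, so that tau = id gives the law
    of the sequence and tau = swap N its invariance. *)
Lemma rect_prob (tau : nat -> nat) n (B : nat -> set R[i]) : involutive tau ->
  (forall k, borelC (B k)) ->
  P [set w | rect n B (path w \o tau)] = (\prod_(k < n) mu (B k))%E.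
Proof.
move=> tauK mB; have [_ ind idd] := iid.
pose J : {fset nat} := [fset k in [seq tau k | k <- iota 0 n]]%fset.
have memJ k : (k \in J) = (tau k < n)%N.
  rewrite inE; apply/mapP/idP => [[j]|tk].
    by rewrite mem_iota/= add0n => j_n ->; rewrite tauK.
  by exists (tau k); rewrite ?tauK// mem_iota.
have -> : [set w | rect n B (path w \o tau)] =
    \bigcap_(k in [set` J]) (a k @^-1` (B (tau k))).
  apply/seteqP; split=> w /= h k.
    by rewrite /= memJ => kn; have := h _ kn; rewrite /path/= tauK.
  by move=> kn; have := h (tau k); rewrite /= memJ tauK; exact.
rewrite (ind J (B \o tau)) => [|k _]; last exact: mB.
have -> : (\prod_(k <- J) P (a k @^-1` (B \o tau) k) =
           \prod_(k <- [seq tau k | k <- iota 0 n]) P (a k @^-1` (B \o tau) k))%E.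
  apply: perm_big; apply: uniq_perm.
  - exact: fset_uniq.
  - by rewrite map_inj_uniq ?iota_uniq//; exact: inv_inj.
  - by move=> k; rewrite inE.
rewrite big_map -[n in iota 0 n]subn0 -/(index_iota 0 n) big_mkord.
by apply: eq_bigr => k _; rewrite /= tauK idd.
Qed.

Lemma path_measurable (tau : nat -> nat) (A : set (@path_space R)) : measurable A ->
  measurable [set w | A (path w \o tau)].
Proof.
move=> mA; have : measurable_fun setT (fun w => path w \o tau : @path_space R).
  apply: (@measurability _ _ _ (@path_space R) _ _ (@rects R)) => //.
  move=> _ [_ [n [B [mB ->]]] <-]; rewrite setTI.
  have -> : (fun w => path w \o tau) @^-1` (rect n B) =
      \bigcap_k (if (k < n)%N then a (tau k) @^-1` (B k) else setT).
    apply/seteqP; split=> w /= h k; first by case: ifP => // /h.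
    by move=> kn; have := h k I; rewrite kn.
  by apply: bigcapT_measurable => k; case: ifP => // _; exact: rv_measurable.
by move=> /(_ measurableT A mA); rewrite setTI.
Qed.

Lemma path_measurable_id (A : set (@path_space R)) : measurable A ->
  measurable [set w | A (path w)].
Proof. exact: (@path_measurable id). Qed.

(** The pi-lambda theorem for the path space. *)
Lemma path_induction (Q : set (set (@path_space R))) :
  Q setT -> (forall n (B : nat -> set R[i]), (forall k, borelC (B k)) -> Q (rect n B)) ->
  (forall S, measurable S -> Q S -> Q (~` S)) ->
  (forall F : (set (@path_space R))^nat, (forall n, measurable (F n)) ->
    trivIset [set: nat] F -> (forall n, Q (F n)) -> Q (\bigcup_k F k)) ->
  forall S, measurable S -> Q S.
Proof.
move=> QT QR QC QU; apply: (@dynkin_induction _ (@path_space R) (@rects R)) => //.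
- exact: rects_setI.
- by move=> _ [n [B [mB ->]]]; exact: QR.
Qed.

Lemma law_swap N (A : set (@path_space R)) : measurable A ->
  P [set w | A (path w)] = P [set w | A (path w \o swap N)].
Proof.
move: A; apply: path_induction => [//|n B mB|S mS IH|F mF tF IH].
- by rewrite (@rect_prob (swap N) n B (swapK N) mB) -(@rect_prob id n B (fun=> erefl) mB).
- rewrite [LHS](@probability_setC _ _ _ P _ (path_measurable_id mS)).
  by rewrite [RHS](@probability_setC _ _ _ P _ (path_measurable _ mS)) IH.
- have UE tau : [set w | (\bigcup_k F k) (path w \o tau)] =
      \bigcup_k [set w | F k (path w \o tau)] by [].
  have tE tau : trivIset setT (fun k => [set w | F k (path w \o tau)]).
    apply/trivIsetP => i j _ _ ij; rewrite -subset0 => w [/= Fi Fj].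
    by have /trivIsetP/(_ i j I I ij) := tF; rewrite -subset0; apply; split; [exact: Fi|exact: Fj].
  rewrite (UE id) UE !measure_bigcup//.
  + by apply: eq_eseriesr => k _; exact: IH.
  + by move=> k _; exact: path_measurable.
  + by move=> k _; exact: (@path_measurable id).
Qed.

Lemma pr_law_swap N (A : set (@path_space R)) : measurable A ->
  pr [set w | A (path w \o swap N)] = pr [set w | A (path w)].
Proof. by move=> mA; rewrite /pr -law_swap. Qed.

(** Cylinders are invariant for large N.  The property passes to complements
    because the law is invariant, and to countable unions because a finite
    subunion carries all but a small part of the probability. *)
Lemma swap_asymptotic (A : set (@path_space R)) : measurable A ->
  forall e : R, 0 < e -> exists N0, forall N, (N0 <= N)%N ->
    pr [set w | A (path w) /\ ~ A (path w \o swap N)] <= e.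
Proof.
have mdiff N S S' : measurable S -> measurable S' ->
    measurable [set w | (S : set (@path_space R)) (path w) /\
                        ~ (S' : set (@path_space R)) (path w \o swap N)].
  move=> mS mS'; have -> : [set w | S (path w) /\ ~ S' (path w \o swap N)] =
      [set w | S (path w)] `\` [set w | S' (path w \o swap N)] by [].
  by apply: measurableD; [exact: path_measurable_id|exact: path_measurable].
move: A; apply: path_induction => [e e0|n B mB e e0|S mS IH e e0|F mF tF IH e e0].
- exists 0%N => N _; rewrite [X in pr X](_ : _ = set0) ?pr_set0 ?ltW//.
  by rewrite -subset0 => w [_]; exact.
- exists n => N nN; rewrite [X in pr X](_ : _ = set0) ?pr_set0 ?ltW//.
  rewrite -subset0 => w /= [h]; apply => k kn /=.
  rewrite swap_id; first exact: h.
    by rewrite ltn_eqF// (leq_trans kn).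
  by rewrite ltn_eqF// ltnS ltnW// (leq_trans kn).
- have [N0 HN0] := IH e e0; exists N0 => N N0N; apply: le_trans (HN0 N N0N).
  have mA := path_measurable_id mS; have mA' := path_measurable (swap N) mS.
  have h1 := pr_split P mA mA'; have h2 := pr_split P mA' mA.
  rewrite setIC in h2; have h3 := pr_law_swap N mS.
  have -> : [set w | (~` S) (path w) /\ ~ (~` S) (path w \o swap N)] =
      [set w | S (path w \o swap N)] `\` [set w | S (path w)].
    by apply/seteqP; split=> w /= [h h']; split=> //; exact: contrapT.
  have : pr ([set w | S (path w)] `\` [set w | S (path w \o swap N)]) =
         pr [set w | S (path w) /\ ~ S (path w \o swap N)] by [].
  lra.
- have e20 : 0 < e / 2 by rewrite divr_gt0.
  have [K HK] := pr_tail P (fun k => path_measurable_id (mF k)) e20.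
  have : exists N0, forall N, (N0 <= N)%N ->
      pr (\big[setU/set0]_(k < K) [set w | F k (path w) /\ ~ F k (path w \o swap N)]) <= e / 2.
    elim: K (e / 2) e20 {HK} => [|K ih] e' e'0.
      by exists 0%N => N _; rewrite big_ord0 pr_set0 ltW.
    have e'20 : 0 < e' / 2 by rewrite divr_gt0.
    have [N1 H1] := ih _ e'20; have [N2 H2] := IH K _ e'20.
    exists (maxn N1 N2) => N; rewrite geq_max => /andP[n1 n2].
    rewrite big_ord_recr/=; apply: le_trans (prU_le _ _ _) _.
    - by apply: bigsetU_measurable => k _; exact: mdiff.
    - exact: mdiff.
    by rewrite [leRHS]splitr lerD// ?H1// ?H2.
  move=> [N0 HN0]; exists N0 => N N0N.
  rewrite [leRHS]splitr; apply: le_trans _ (lerD (HN0 N N0N) HK).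
  have mU1 : measurable (\big[setU/set0]_(k < K) [set w | F k (path w) /\ ~ F k (path w \o swap N)]).
    by apply: bigsetU_measurable => k _; exact: mdiff.
  have mU2 : measurable ((\bigcup_k [set w | F k (path w)]) `\`
                         \big[setU/set0]_(k < K) [set w | F k (path w)]).
    apply: measurableD; first by apply: bigcupT_measurable => k; exact: path_measurable_id.
    by apply: bigsetU_measurable => k _; exact: path_measurable_id.
  apply: le_trans _ (prU_le _ mU1 mU2); apply: pr_le.
  + by apply: mdiff; exact: bigcupT_measurable.
  + exact: measurableU.
  + move=> w [[k _ Fk] nF].
    have [kK|Kk] := pselect (exists2 i, (i < K)%N & F i (path w)).
      left; move: kK => [i iK Fi]; apply/(bigsetU_ordP (fun k => [set w | F k (path w) /\ ~ F k (path w \o swap N)])).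
      exists i => //; split=> // Fi'.
      by apply: nF; exists i.
    right; split; first by exists k.
    by move=> /(bigsetU_ordP (fun k => [set w | F k (path w)]))[i iK Fi]; apply: Kk; exists i.
Qed.

Section Mixing.
Variables (B B' : set R[i]).
Hypotheses (mB : borelC B) (mB' : borelC B').

Definition consecutive N : set T := [set w | B (a N w) /\ B' (a N.+1 w)].

Let beta := pr (a 0 @^-1` B) * pr (a 0 @^-1` B').

Lemma consecutive_measurable N : measurable (consecutive N).
Proof. by apply: measurableI; exact: rv_measurable. Qed.

Lemma rect_consecutive n (C : nat -> set R[i]) N : (n <= N)%N -> (forall k, borelC (C k)) ->
  pr ([set w | rect n C (path w)] `&` consecutive N) =
  pr [set w | rect n C (path w)] * beta.
Proof.
move=> nN mC.
pose C1 k := if (k < n)%N then C k else setT.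
have mC1 k : borelC (C1 k) by rewrite /C1; case: ifP => // _; exact: borelCT.
pose C2 k := if (k < N)%N then C1 k else if k == N then B else B'.
have mC2 k : borelC (C2 k).
  by rewrite /C2; case: ifP => // _; case: ifP.
have -> : [set w | rect n C (path w)] `&` consecutive N =
    [set w | rect N.+2 C2 (path w \o id)].
  apply/seteqP; split=> w /=.
    rewrite (rect_extend C nN) => -[h [hB hB']] k.
    rewrite ltnS leq_eqVlt => /orP[/eqP ->|].
      by rewrite /C2 ltnNge leqnSn/= gtn_eqF.
    rewrite ltnS leq_eqVlt => /orP[/eqP ->|kN].
      by rewrite /C2 ltnn eqxx.
    by rewrite /C2 kN; exact: h.
  rewrite (rect_extend C nN) => h; split.
    by move=> k kN; have := h k (leqW (leqW kN)); rewrite /C2 kN.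
  split; first by have := h N (leqnSn _); rewrite /C2 ltnn eqxx.
  by have := h N.+1 (ltnSn _); rewrite /C2 ltnNge leqnSn/= gtn_eqF.
apply: EFin_inj.
have mrect m D (mD : forall k, borelC (D k)) : measurable [set w | rect m D (path w)].
  by apply: path_measurable_id; apply: sub_sigma_algebra; exists m, D.
rewrite -prE; last exact: mrect.
rewrite (@rect_prob id)// 2!big_ord_recr/= /beta !EFinM -!prE; last 3 first.
- exact: rv_measurable.
- exact: rv_measurable.
- exact: mrect.
have -> : C2 N = B by rewrite /C2 ltnn eqxx.
have -> : C2 N.+1 = B' by rewrite /C2 ltnNge leqnSn/= gtn_eqF.
rewrite -muleA; congr (_ * _)%E.
rewrite (rect_extend C nN) -[path]/(fun w => path w \o id) (@rect_prob id)//.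
by apply: eq_bigr => k _; rewrite /C2 ltn_ord.
Qed.

Lemma pr_consecutive N : pr (consecutive N) = beta.
Proof.
have := @rect_consecutive 0 (fun=> setT) N (leq0n _) (fun=> borelCT).
have -> : [set w | rect 0 (fun=> setT) (path w)] = setT by apply/seteqP; split.
by rewrite setTI pr_setT mul1r.
Qed.

(** For cylinders the independence is exact as soon as N exceeds their length;
    complements and disjoint unions are handled as in [swap_asymptotic]. *)
Lemma mixing (A : set (@path_space R)) : measurable A ->
  forall e : R, 0 < e -> exists N0, forall N, (N0 <= N)%N ->
    `|pr ([set w | A (path w)] `&` consecutive N) - pr [set w | A (path w)] * beta| <= e.
Proof.
have mE := consecutive_measurable.
have beta01 : 0 <= beta <= 1.
  by rewrite -(pr_consecutive 0) pr_ge0 -(pr_setT P) pr_le.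
move: A; apply: path_induction => [e e0|n C mC e e0|S mS IH e e0|F mF tF IH e e0].
- by exists 0%N => N _; rewrite setTI pr_consecutive pr_setT mul1r subrr normr0 ltW.
- by exists n => N nN; rewrite rect_consecutive// subrr normr0 ltW.
- have [N0 HN0] := IH e e0; exists N0 => N /HN0.
  have mA := path_measurable_id mS.
  have := pr_split P (mE N) mA; rewrite pr_consecutive setDE ![consecutive N `&` _]setIC.
  have := pr_setC P mA.
  have -> : [set w | (~` S) (path w)] = ~` [set w | S (path w)] by [].
  move=> -> E; rewrite !ler_norml; nra.
- have e40 : 0 < e / 4 by rewrite divr_gt0.
  have mA k := path_measurable_id (mF k).
  have [K HK] := pr_tail P mA e40.
  pose V := \big[setU/set0]_(k < K) [set w | F k (path w)].
  have mV : measurable V by exact: bigsetU_measurable.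
  have [N0 HN0] : exists N0, forall N, (N0 <= N)%N ->
      `|pr (V `&` consecutive N) - pr V * beta| <= e / 2.
    rewrite /V; elim: K (e / 2) (divr_gt0 e0 (ltr0n _ 2)) {HK V mV} => [|K ih] e' e'0.
      by exists 0%N => N _; rewrite big_ord0 set0I pr_set0 mul0r subrr normr0 ltW.
    have e'20 : 0 < e' / 2 by rewrite divr_gt0.
    have [N1 H1] := ih _ e'20; have [N2 H2] := IH K _ e'20.
    exists (maxn N1 N2) => N; rewrite geq_max => /andP[n1 n2].
    rewrite big_ord_recr/=.
    set V := \big[setU/set0]_(k < K) _; set W := [set w | F K (path w)].
    have mV : measurable V by exact: bigsetU_measurable.
    have mW : measurable W by exact: mA.
    have VW : V `&` W = set0.
      rewrite -subset0 => w [/(bigsetU_ordP (fun k => [set w | F k (path w)]))[i iK Fi] Wk].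
      have iK' : i != K by rewrite ltn_eqF.
      have /trivIsetP/(_ i K I I iK') := tF; rewrite -subset0; apply.
      by split; [exact: Fi|exact: Wk].
    rewrite setIUl prU//; [|exact: measurableI..|]; last first.
      by rewrite setIACA VW set0I.
    rewrite prU//.
    have -> : pr (V `&` consecutive N) + pr (W `&` consecutive N) - (pr V + pr W) * beta =
       (pr (V `&` consecutive N) - pr V * beta) +
       (pr (W `&` consecutive N) - pr W * beta) by ring.
    apply: (le_trans (ler_normD _ _)); rewrite [leRHS]splitr; apply: lerD.
      exact: H1.
    exact: H2.
  exists N0 => N N0N; have := HN0 N N0N.
  pose U := \bigcup_k [set w | F k (path w)].
  have -> : [set w | (\bigcup_k F k) (path w)] = U by [].
  have mU : measurable U by exact: bigcupT_measurable.
  have VU : V `<=` U.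
    by move=> w /(bigsetU_ordP (fun k => [set w | F k (path w)]))[i _ Fi]; exists i.
  have h1 := pr_split P mU mV; rewrite setIC (setIidl VU) in h1.
  have h2 := pr_split P (measurableI _ _ mU (mE N)) mV.
  have VE : (U `&` consecutive N) `&` V = V `&` consecutive N.
    by rewrite setIC setIA (setIidl VU).
  rewrite VE in h2.
  have h3 : pr ((U `&` consecutive N) `\` V) <= pr (U `\` V).
    by apply: pr_le; [apply: measurableD => //; exact: measurableI|exact: measurableD|
      move=> w [[? _] ?]].
  have h4 := pr_ge0 P ((U `&` consecutive N) `\` V).
  have h5 : pr (U `\` V) <= e / 4 by exact: HK.
  have h6 := pr_ge0 P (U `\` V).
  rewrite !ler_norml; move: h2 h1 h3 h4 h5 h6.
  set p1 := pr (_ `\` _); set p2 := pr (U `\` V); set p3 := pr (V `&` _).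
  by move=> -> ->; have /andP[b0 b1] := beta01; nra.
Qed.

(** On A and on the event that a_N, a_N.+1 lie in B, B', the exchanged path
    leaves A when N is large.  The probability of this event is close to
    P(A) beta by [mixing] and close to 0 by [swap_asymptotic]. *)
Lemma swap_rigid_null (A : set (@path_space R)) : measurable A -> swap_rigid A ->
  B `&` B' = set0 -> 0 < beta -> P [set w | A (path w)] = 0%E.
Proof.
move=> mA [N0 rig] BB' b0.
have mA' := path_measurable_id mA.
suff : pr [set w | A (path w)] * beta <= 0.
  rewrite pmulr_lle0// => h; rewrite prE//; congr (_%:E).
  by apply/eqP; rewrite eq_le h pr_ge0.
apply/ler_addgt0Pr => e e0; rewrite add0r.
have e20 : 0 < e / 2 by rewrite divr_gt0.
have [N1 H1] := mixing mA e20; have [N2 H2] := swap_asymptotic mA e20.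
pose N := maxn N0 (maxn N1 N2).
have /H1 : (N1 <= N)%N by rewrite /N !leq_max leqnn !orbT.
have /H2 : (N2 <= N)%N by rewrite /N !leq_max leqnn !orbT.
have N0N : (N0 <= N)%N by rewrite /N leq_max leqnn.
have : pr ([set w | A (path w)] `&` consecutive N) <=
       pr [set w | A (path w) /\ ~ A (path w \o swap N)].
  apply: pr_le.
  - by apply: measurableI => //; exact: consecutive_measurable.
  - by apply: measurableD => //; exact: path_measurable.
  - move=> w [Aw [Bw Bw']]; split=> // sAw; rewrite -falseE.
    have := rig N (path w) N0N Aw sAw; rewrite /path => E.
    have : (B `&` B') (a N w) by split=> //; rewrite E.
    by rewrite BB'.
by rewrite ler_norml => ? ? /andP[]; lra.
Qed.

End Mixing.

End IIDPaths.

(** * Sums of tail probabilities *)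

Section TailSum.
Context {R : realType} {d : measure_display} {T : measurableType d}.
Variable P : probability T R.

(** If the last term is 1 then y / e is at least its index K, and the sum is at
    most K + 1 anyway. *)
Lemma count_below (y e : R) K : 0 < e -> 0 <= y ->
  \sum_(k < K) ((k%:R * e < y)%R%:R : R) <= e^-1 * y + 1.
Proof.
move=> e0 y0; have ey : 0 <= e^-1 * y by rewrite mulr_ge0// invr_ge0 ltW.
elim: K => [|K ih]; first by rewrite big_ord0 addr_ge0.
rewrite big_ord_recr/=; case: ltP => Ky; last by rewrite addr0.
apply: lerD => //; apply: (@le_trans _ _ K%:R).
  rewrite -[leRHS]mulr1 -[K in leRHS]card_ord -sum1_card natr_sum -[leLHS]mulr1 mulr_suml mulr_suml.
  by apply: ler_sum => i _; rewrite mulr1 mulr1 lern1 leq_b1.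
by rewrite mulrC ler_pdivlMr// ltW.
Qed.

(** Integrate [count_below] at y = Y w. *)
Lemma tail_sum_lty (Y : T -> R) (e : R) : 0 < e -> measurable_fun setT Y ->
  (forall w, 0 <= Y w) -> ('E_P[Y] < +oo)%E ->
  (\sum_(k <oo) P [set w | (k%:R * e < Y w)%R] < +oo)%E.
Proof.
move=> e0 mY Y0; rewrite unlock => EY.
have mX k : measurable [set w | (k%:R * e < Y w)%R].
  have := mY measurableT `]k%:R * e, +oo[%classic (measurable_itv _).
  by rewrite setTI preimage_itvoy.
have mYE : measurable_fun setT (fun w => (Y w)%:E) by exact/measurable_EFinP.
have e10 : 0 <= e^-1 by rewrite invr_ge0 ltW.
apply: (@le_lt_trans _ _ ((e^-1)%:E * \int[P]_w (Y w)%:E + 1)%E); last first.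
  rewrite lte_add_pinfty ?ltry// lte_mul_pinfty// ?lee_fin//.
apply: lime_le; first exact: is_cvg_nneseries.
apply: nearW => K.
rewrite big_mkord.
have -> : (\sum_(k < K) P [set w | (k%:R * e < Y w)%R] =
    \int[P]_w (\sum_(k < K) (\1_[set w | (k%:R * e < Y w)%R] w)%:E)%E)%E.
  rewrite ge0_integral_sum//.
  - by apply: eq_bigr => k _; rewrite integral_indic// setIT.
  - by move=> k; apply/measurable_EFinP; exact: measurable_indic.
have -> : ((e^-1)%:E * \int[P]_w (Y w)%:E + 1 =
           \int[P]_w ((e^-1)%:E * (Y w)%:E + 1)%E)%E.
  rewrite ge0_integralD//.
  - rewrite ge0_integralZl_EFin//; first by rewrite integral_cst//= probability_setT mule1.
    by move=> w _; rewrite lee_fin.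
  - by move=> w _; rewrite -EFinM lee_fin mulr_ge0.
  - by apply: measurable_funeM.
apply: ge0_le_integral => //.
- by move=> w _; rewrite sume_ge0// => k _; rewrite lee_fin.
- by apply: emeasurable_sum => k; apply/measurable_EFinP; exact: measurable_indic.
- by apply: emeasurable_funD => //; apply: measurable_funeM.
- move=> w _; rewrite -EFinM -EFinD sumEFin lee_fin.
  apply: le_trans (count_below K e0 (Y0 w)); apply: ler_sum => k _.
  by rewrite indicE mem_setE.
Qed.

End TailSum.

(** * Random power series *)

Section RandomPowerSeries.
Context {R : realType} {d : measure_display} {T : measurableType d}.
Variables (P : probability T R) (a : nat -> T -> R[i]).
Hypothesis iid : iid_seq P a.

Local Notation path := (path a).

(** By Borel-Cantelli, ln (1 + |a_k|) exceeds - k ln t for finitely many k only: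
    the probabilities of these events are tail probabilities of ln (1 + |a_0|)
    along an arithmetic progression. *)
Lemma ae_tame : ('E_P[fun w => ln (1 + Normc.normc (a 0%N w))] < +oo)%E ->
  {ae P, forall w, tame (path w)}.
Proof.
move=> EY.
have mrv := rv_measurable iid.
suff h n : {ae P, forall w, exists M : nat, coef_bound (outer_radius n) M%:R (path w)}.
  by apply: filterS (ae_foralln h) => w hw; exact/tameP.
have /andP[t0 t1] := @outer_radius_lt1 R n; set t := outer_radius n in t0 t1 *.
pose e := - ln t.
have e0 : 0 < e by rewrite oppr_gt0 ln_lt0// t0.
pose Y w := ln (1 + nc (a 0%N w)).
have Y0 w : 0 <= Y w by rewrite ln_ge0// lerDl nc_ge0.
have mnc : measurable_fun setT (fun w => 1 + nc (a 0%N w)).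
  apply: measurable_funD; first exact: measurable_cst.
  apply: measurable_fun_gt => y.
  by apply: (mrv 0%N [set z | y < nc z]); apply: borelC_open; exact: open_nc_gt.
have mY : measurable_fun setT Y by exact: measurableT_comp (@measurable_ln R) mnc.
pose B k : set R[i] := [set z | t ^- k - 1 < nc z].
have mB k : borelC (B k) by apply: borelC_open; exact: open_nc_gt.
have BE k : a 0%N @^-1` (B k) = [set w | (k%:R * e < Y w)%R].
  apply/seteqP; split=> w; rewrite /B/= ltrBlDl /Y /e mulrN mulr_natl -lnXn// -lnV ?posrE ?exprn_gt0//;
    by rewrite ltr_ln// posrE ?invr_gt0 ?exprn_gt0// ltr_wpDr ?nc_ge0.
have : (\sum_(k <oo) P (a k @^-1` (B k)) < +oo)%E.
  have [_ _ idd] := iid.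
  rewrite (@eq_eseriesr _ _ (fun k => P [set w | (k%:R * e < Y w)%R])).
    exact: tail_sum_lty.
  by move=> k _; rewrite idd// BE.
move=> /(lim_sup_set_cvg0 (fun k => mrv k _ (mB k))) L0.
exists (lim_sup_set (fun k => a k @^-1` (B k))); split=> //.
  apply: bigcapT_measurable => j; apply: bigcup_measurable => k _; exact: mrv.
move=> w /= nM j _; apply: contrapT => nj; apply: nM.
have hk k : (j <= k)%N -> nc (path w k) * t ^+ k <= 1.
  move=> jk; have : ~ B k (path w k) by move=> Bk; apply: nj; exists k.
  move=> /negP; rewrite /B/= -leNgt lerBrDl => h.
  rewrite -ler_pdivlMr ?exprn_gt0// mul1r; apply: le_trans h.
  by rewrite lerDr.
have [M M0 cM] := coef_bound_eventually (ltW t0) hk.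
exact: coef_bound_nat cM.
Qed.

Lemma path_derive1 w z : tame (path w) -> nc z < 1 -> z != 0 ->
  (derive1 (power_series (path w)) z == 0) = (euler 1 (path w) z == 0).
Proof.
move=> tw z1 z0; rewrite tame_derive//.
have [|s [t [zs st /tw[M cM]]]] := @radii_between R (nc z); first by rewrite nc_ge0.
by rewrite -(mul_deuler st cM 0 (ltW zs)) mulf_eq0 (negbTE z0).
Qed.

(** Two distinct complex numbers lie on opposite sides of a vertical or
    horizontal line with rational abscissa or ordinate.  If no such pair of open
    half-planes is charged on both sides, then a_k <> a_0 has probability 0. *)
Lemma separation_or_constant :
  (exists B B' : set R[i], [/\ borelC B, borelC B', B `&` B' = set0 &
     0 < pr P (a 0 @^-1` B) * pr P (a 0 @^-1` B')]) \/
  P.-negligible [set w | exists k, a k w != a 0%N w].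
Proof.
have [sep|nsep] := pselect (exists B B' : set R[i], [/\ borelC B, borelC B',
    B `&` B' = set0 & 0 < pr P (a 0 @^-1` B) * pr P (a 0 @^-1` B')]); [by left|right].
have [_ _ idd] := iid; have mrv := rv_measurable iid.
have null (B B' : set R[i]) k : borelC B -> borelC B' -> B `&` B' = set0 ->
    P.-negligible [set w | B (a 0%N w) /\ B' (a k w)].
  move=> mB mB' BB'.
  have : pr P (a 0 @^-1` B) * pr P (a 0 @^-1` B') = 0.
    apply/eqP; apply: contrapT => /negP n0; apply: nsep; exists B, B'; split=> //.
    by rewrite lt_neqAle eq_sym n0 mulr_ge0// pr_ge0.
  move/eqP; rewrite mulf_eq0 => /orP[] /eqP p0.
    apply: (@negligibleS _ _ _ _ (a 0 @^-1` B)); first by move=> w [].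
    by apply/negligibleP; [exact: mrv|have := prE P (mrv 0%N B mB); rewrite p0].
  apply: (@negligibleS _ _ _ _ (a k @^-1` B')); first by move=> w [].
  apply/negligibleP; first exact: mrv.
  by have := prE P (mrv 0%N B' mB'); rewrite p0 -(idd k).
pose H (q : rat) (i : nat) : set R[i] := match i with
  | 0 => [set z | complex.Re z < ratr q] | 1 => [set z | ratr q < complex.Re z]
  | 2 => [set z | complex.Im z < ratr q] | _ => [set z | ratr q < complex.Im z] end.
have mH q i : borelC (H q i).
  by case: i => [|[|[|i]]]; apply: borelC_open;
    [exact: open_Re_lt|exact: open_Re_gt|exact: open_Im_lt|exact: open_Im_gt].
have disj (f : R[i] -> R) (u : R) : [set z | f z < u] `&` [set z | u < f z] = set0.
  by rewrite -subset0 => z [/= h1 h2]; have := lt_trans h1 h2; rewrite ltxx.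
pose D (k n : nat) : set T := if (choice.unpickle n : option rat) is Some q then
    ([set w | H q 0 (a 0%N w) /\ H q 1 (a k w)] `|` [set w | H q 1 (a 0%N w) /\ H q 0 (a k w)])
    `|` ([set w | H q 2 (a 0%N w) /\ H q 3 (a k w)] `|` [set w | H q 3 (a 0%N w) /\ H q 2 (a k w)])
  else set0.
apply: (@negligibleS _ _ _ _ (\bigcup_k \bigcup_n D k n)); last first.
  apply: negligible_bigcup => k; apply: negligible_bigcup => n; rewrite /D.
  case: (choice.unpickle n) => [q|]; last exact: negligible_set0.
  by apply: negligibleU; apply: negligibleU; apply: null => //; rewrite ?disj// setIC disj.
move=> w [k]; rewrite eq_complex negb_and => kw; exists k => //.
have sepq (u v : R) : u < v -> exists q : rat, u < ratr q < v.
  by move=> /rat_in_itvoo[q]; rewrite in_itv/=; exists q.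
suff [q Dq] : exists q : rat,
    ((H q 0 (a 0%N w) /\ H q 1 (a k w)) \/ (H q 1 (a 0%N w) /\ H q 0 (a k w))) \/
    ((H q 2 (a 0%N w) /\ H q 3 (a k w)) \/ (H q 3 (a 0%N w) /\ H q 2 (a k w))).
  by exists (choice.pickle q); [exact: I|rewrite /D choice.pickleK; exact: Dq].
case/orP: kw => /lt_total/orP[] /sepq[q /andP[q1 q2]]; exists q.
- by left; right; split.
- by left; left; split.
- by right; right; split.
- by right; left; split.
Qed.

(** The partial sums are c (1 - z^n) / (1 - z), and |1 - z^n| >= 1 - |z| for n > 0. *)
Lemma constant_coef_eq0 (c : nat -> R[i]) z : (forall k, c k = c 0%N) ->
  tame c -> nc z < 1 -> euler 0 c z = 0 -> c 0%N = 0.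
Proof.
move=> cc tc z1 e0.
have /csum_cvg := @tame_euler_asum R 0 c z tc z1; rewrite -/(euler 0 c z) e0.
have -> : series (fun k => k%:R ^+ 0 * c k * z ^+ k) =
          (fun n => c 0%N * \sum_(k < n) z ^+ k).
  apply/funext => n; rewrite /series/= big_mkord mulr_sumr.
  by apply: eq_bigr => k _; rewrite expr0 mul1r cc.
move=> /cvg_ncP lim0; apply/eqP; rewrite -nc_eq0; apply/negPn/negP => c0.
have c00 : 0 < nc (c 0%N) by rewrite lt_neqAle eq_sym c0 nc_ge0.
pose kappa := nc (c 0%N) * (1 - nc z).
have kappa0 : 0 < kappa by rewrite mulr_gt0// subr_gt0.
have [N HN] := lim0 (kappa / 2) (divr_gt0 kappa0 (ltr0n _ 2)).
have := HN N.+1 (leqnSn N); rewrite sub0r ncN ncM => hS.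
have zN : nc z ^+ N.+1 <= nc z by rewrite exprS ler_piMr ?nc_ge0// exprn_ile1 ?nc_ge0// ltW.
have : 1 - nc z <= 2 * nc (\sum_(k < N.+1) z ^+ k).
  apply: (@le_trans _ _ (nc (z ^+ N.+1 - 1))).
    rewrite nc_distC; apply: le_trans (nc_subl _ _).
    by rewrite nc1 ncX lerD2l lerN2.
  rewrite subrX1 ncM ler_wpM2r ?nc_ge0//; apply: (le_trans (ncB _ _)).
  by rewrite nc1; lra.
rewrite /kappa in hS kappa0 *; nra.
Qed.

End RandomPowerSeries.

Unset Implicit Arguments.

Theorem theorem1p3 (R : realType) (d : measure_display) (T : measurableType d)
    (P : probability T R) (a : nat -> T -> R[i]) :
  iid_seq P a ->
  ('E_P[fun w => ln (1 + Normc.normc (a 0%N w))] < +oo)%E ->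
  let F (w : T) : R[i] -> R[i] := power_series (fun k => a k w) in
  let analytic (w : T) : Prop := analytic_power_series (fun k => a k w) in
  let double_zero_in_disk : set T :=
    [set w | analytic w /\
       exists alpha, [/\ unit_disk alpha, F w alpha = 0
                       & derive1 (F w) alpha = 0]] in
  let double_zero_at_0 : set T :=
    [set w | analytic w /\ F w 0 = 0 /\ derive1 (F w) 0 = 0] in
  [/\ {ae P, forall w, analytic w},
      measurable double_zero_in_disk,
      measurable double_zero_at_0,
      P double_zero_in_disk = P double_zero_at_0
    & P double_zero_at_0 = ((P [set w | a 0%N w = 0%R]) ^+ 2)%E].
Proof.
move=> iid EY F analytic double_zero_in_disk double_zero_at_0.
have analyticE w : analytic w <-> tame (path a w) by exact: analytic_tame.
have aet := ae_tame iid EY.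
have ae_an : {ae P, forall w, analytic w} by apply: filterS aet => w /analyticE.
pose C0 := @consecutive R d T a [set 0] [set 0] 0%N.
have b0 := @borelC_set1_0 R.
have mC0 : measurable C0 by exact: (consecutive_measurable iid b0 b0).
pose Tm := [set w | tame (path a w)].
have mT : measurable Tm by exact: (path_measurable_id iid tame_measurable).
have at0E : double_zero_at_0 = Tm `&` C0.
  apply/seteqP; split=> w.
    move=> [/analyticE tw [F0 F'0]]; split=> //.
    split; first by move: F0; rewrite /F -/(path a w) power_seriesE euler_at0.
    by move: F'0; rewrite /F -/(path a w) tame_derive ?nc0// deuler_at0.
  move=> [tw [a0 a1]]; split; first exact/analyticE.
  split; first by rewrite /F -/(path a w) power_seriesE euler_at0.
  by rewrite /F -/(path a w) tame_derive ?nc0// deuler_at0.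
have m0 : measurable double_zero_at_0 by rewrite at0E; exact: measurableI.
pose Off := [set w | double_zero_off_0 (path a w)].
have mOff : measurable Off by exact: (path_measurable_id iid double_zero_off_0_measurable).
have diskE : double_zero_in_disk = double_zero_at_0 `|` Off.
  apply/seteqP; split=> w.
    move=> [aw [z [/unit_diskE z1 Fz F'z]]]; have tw := (analyticE w).1 aw.
    have [z0|z0] := eqVneq z 0; first by left; rewrite z0 in Fz F'z.
    right; split=> //; exists z; split=> //.
      by move: Fz; rewrite /F -/(path a w) power_seriesE.
    by apply/eqP; rewrite -path_derive1//; apply/eqP.
  move=> [[aw [F0 F'0]]|[tw [z [z0 z1 e0 e1]]]].
    by split=> //; exists 0; split=> //; apply/unit_diskE; rewrite nc0.
  split; first exact/analyticE.
  exists z; split; first exact/unit_diskE.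
    by rewrite /F -/(path a w) power_seriesE.
  by apply/eqP; rewrite /F -/(path a w) path_derive1// e1.
have off_null : P (Off `\` double_zero_at_0) = 0%E.
  apply: measure_negligible; first exact: measurableD.
  have off_nz w : (Off `\` double_zero_at_0) w -> exists k, path a w k != 0.
    move=> [[tw _] n0]; apply: contrapT => all0; apply: n0; rewrite at0E.
    have z k : path a w k = 0.
      by apply: contrapT => /eqP kn; apply: all0; exists k.
    by split=> //; split; exact: z.
  have [[B [B' [mB mB' BB' beta0]]]|const] := separation_or_constant iid.
    have [J [A [mA rigA cover]]] := @double_zero_off_0_cover R.
    apply: (@negligibleS _ _ _ _
        (\bigcup_n (if (choice.unpickle n : option J) is Some i then [set w | A i (path a w)]
                    else set0))).
      move=> w /[dup] /off_nz nz [offw _]; have [i Ai] := cover _ offw nz.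
      by exists (choice.pickle i); [exact: I|rewrite choice.pickleK].
    apply: negligible_bigcup => n; case: (choice.unpickle n) => [i|]; last exact: negligible_set0.
    apply/negligibleP; first exact: (path_measurable_id iid (mA i)).
    exact: (swap_rigid_null iid mB mB' (mA i) (rigA i) BB' beta0).
  apply: negligibleS const => w /[dup] /off_nz [k wk] [[tw [z [z0 z1 e0 _]]] _].
  apply: contrapT => cst_w.
  have cc j : path a w j = path a w 0%N.
    by apply: contrapT => /eqP nj; apply: cst_w; exists j.
  by rewrite cc (constant_coef_eq0 cc tw z1 e0) eqxx in wk.
split=> //.
- by rewrite diskE; exact: measurableU.
- have -> : double_zero_in_disk = double_zero_at_0 `|` (Off `\` double_zero_at_0).
    by rewrite setUDr setDv setD0.
  by apply: measureU0 => //; exact: measurableD.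
- have C0T : P (C0 `\` Tm) = 0%E.
    apply: measure_negligible; first exact: measurableD.
    by apply: negligibleS aet => w [].
  have prC0 := pr_split P mC0 mT; rewrite {3}/pr C0T addr0 setIC -at0E in prC0.
  have m00 := rv_measurable iid 0%N b0.
  have -> : [set w | a 0%N w = 0%R] = a 0%N @^-1` [set 0] by [].
  by rewrite (prE P m0) -prC0 (pr_consecutive iid b0 b0) expe2 (prE P m00) EFinM.
Qed.
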